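(* Let $G$ be a connected unicyclic graph on $n$ vertices and let $S=k[x_1,\ldots,x_n,y_1,\ldots,y_n]$ be a polynomial ring over a field $k$. Then the edge-binomials of $G$ form a $d$-sequence in $S$ if and only if $G$ has one of the following forms: (a) $G$ is obtained from some tree $H\in\mathcal{T}_m$ (for some $m\ge 2$) by adding an edge between a pendant vertex of $H$ and the center of $H$; (b) $G$ is obtained from some tree $H\in\mathcal{T}_m$ (for some $m\ge 2$) by adding an edge between the center of $H$ and an internal vertex of $H$; (c) $G=C_n$ is the cycle on $n$ vertices, $n\geq 3$. Moreover, if $\operatorname{char}(k)\neq 2$ and $G$ has one of the forms (a), (b), (c), then the parity edge-binomials of $G$ form a $d$-sequence in $S$.
   Context: All graphs are finite and simple. A unicyclic graph is a graph containing exactly one cycle as a subgraph. For a graph $G$ on vertex set $[n]=\{1,\dots,n\}$, the edge-binomial of an edge $\{i,j\}$ is $f_{ij}=x_iy_j-x_jy_i$ and the parity edge-binomial is $g_{ij}=x_ix_j-y_iy_j$. $d$-sequence: let $R$ be a commutative ring and $a_0=0$. A sequence $a_1,\ldots,a_r$ in $R$ is a $d$-sequence if (i) $a_1,\ldots,a_r$ is a minimal system of generators of $(a_1,\ldots,a_r)$, and (ii) $(a_0,\ldots,a_i):a_{i+1}a_j=(a_0,\ldots,a_i):a_j$ for all $0\le i\le r-1$ and all $j\ge i+1$. ''The (parity) edge-binomials of $G$ form a $d$-sequence'' means that the set of all (parity) edge-binomials of $G$ can be arranged in some order that is a $d$-sequence. The class $\mathcal{T}_m$ ($m\ge 2$):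 trees $H$ with vertex set $\{k_0\}\cup\{p_{i,j}: 1\le i\le m,\ 1\le j\le s(i)+1\}$, where $s(i)\ge 0$ for all $i$, and edge set $\{\{k_0,p_{i,1}\}:1\le i\le m\}\cup\bigcup_{i=1}^m\{\{p_{i,j},p_{i,j+1}\}:1\le j\le s(i)\}$; that is, $m$ paths attached at a vertex $k_0$ of degree $m$. The vertex $k_0$ is called the center of $H$ (for $m=2$, $H$ is a path with a designated non-end vertex $k_0$). A pendant vertex is a vertex of degree $1$; an internal vertex of the tree $H$ is a vertex of degree at least $2$. Adding an edge to $H$ always means joining two distinct non-adjacent vertices of $H$. *)

(* Defs.v *)
From mathcomp Require Import all_boot all_order all_algebra.
From mathcomp Require Export mpoly.

Set Implicit Arguments.
Unset Strict Implicit.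
Unset Printing Implicit Defensive.

Import GRing.Theory.
Local Open Scope ring_scope.

Definition gen_ideal (R : comNzRingType) (s : seq R) (x : R) : Prop :=
  exists c : 'I_(size s) -> R, x = \sum_(i < size s) c i * s`_i.

Definition colon (R : comNzRingType) (I : R -> Prop) (b x : R) : Prop :=
  I (x * b).

Definition minimal_generators (R : comNzRingType) (s : seq R) : Prop :=
  forall t : seq R, subseq t s -> t != s ->
    ~ (forall x, gen_ideal t x <-> gen_ideal s x).

(* The list s = [:: a_1; ...; a_r] is indexed from 0, so s`_i is a_(i+1) and
   0 :: take i s is a_0, a_1, ..., a_i. *)
Definition d_sequence (R : comNzRingType) (s : seq R) : Prop :=
  minimal_generators s /\
  forall i j : nat, (i <= j < size s)%N -> forall x : R,
    colon (gen_ideal (0 :: take i s)) (s`_i * s`_j) x <->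
    colon (gen_ideal (0 :: take i s)) (s`_j) x.

Section Binomials.
Variables (k : fieldType) (n : nat).

(* The first n variables of {mpoly k[n + n]} are the x_i, the last n the y_i. *)
Definition xvar (i : 'I_n) : {mpoly k[n + n]} := 'X_(lshift n i).
Definition yvar (i : 'I_n) : {mpoly k[n + n]} := 'X_(rshift n i).

Definition edge_binomial (i j : 'I_n) : {mpoly k[n + n]} :=
  xvar i * yvar j - xvar j * yvar i.

Definition parity_edge_binomial (i j : 'I_n) : {mpoly k[n + n]} :=
  xvar i * xvar j - yvar i * yvar j.

(* Each edge {i, j} contributes a single binomial, the one with i < j; this
   fixes the sign of f_ij = - f_ji. *)
Definition binomials_of (b : 'I_n -> 'I_n -> {mpoly k[n + n]})
    (e : rel 'I_n) : seq {mpoly k[n + n]} :=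
  [seq b p.1 p.2 | p : 'I_n * 'I_n <- enum {: 'I_n * 'I_n} &
                   (p.1 < p.2)%N && e p.1 p.2].

Definition form_d_sequence (b : 'I_n -> 'I_n -> {mpoly k[n + n]})
    (e : rel 'I_n) : Prop :=
  exists2 s, perm_eq s (binomials_of b e) & d_sequence s.

End Binomials.

Definition edge_binomials_form_d_sequence (k : fieldType) (n : nat)
    (e : rel 'I_n) : Prop :=
  form_d_sequence (@edge_binomial k n) e.

Definition parity_edge_binomials_form_d_sequence (k : fieldType) (n : nat)
    (e : rel 'I_n) : Prop :=
  form_d_sequence (@parity_edge_binomial k n) e.

Definition connected_graph (V : finType) (e : rel V) : Prop :=
  (0 < #|V|)%N /\ forall x y : V, connect e x y.

(* A subgraph is a pair (vertex set, edge set); rotating or reversing the list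
   c does not change the subgraph. *)
Definition is_cycle_subgraph (V : finType) (e : rel V)
    (C : {set V} * {set {set V}}) : Prop :=
  exists c : seq V, [/\ ucycle e c, (3 <= size c)%N &
    C = ([set x in c], [set [set x; next c x] | x in c])].

Definition unicyclic (V : finType) (e : rel V) : Prop :=
  exists! C : {set V} * {set {set V}}, is_cycle_subgraph e C.

Definition graph_iso (V W : finType) (e : rel V) (f : rel W) (phi : V -> W) :
    Prop :=
  bijective phi /\ forall x y, f (phi x) (phi y) = e x y.

Definition degree (V : finType) (h : rel V) (v : V) : nat :=
  #|[set w | h v w]|.

Definition pendant (V : finType) (h : rel V) (v : V) : Prop := degree h v = 1%N.

Definition internal (V : finType) (h : rel V) (v : V) : Prop :=
  (2 <= degree h v)%N.

(* None is k_0; Some (Tagged _ j) over i : 'I_m is p_(i+1, j+1). *)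
Definition spider_vertex (m : nat) (s : 'I_m -> nat) : finType :=
  option {i : 'I_m & 'I_(s i).+1}.

Definition spider_adj (m : nat) (s : 'I_m -> nat) : rel (spider_vertex s) :=
  fun u v => match u, v with
  | None, None => false
  | None, Some p | Some p, None => tagged p == 0 :> nat
  | Some p, Some q => (tag p == tag q) &&
      ((tagged q == (tagged p).+1 :> nat) || (tagged p == (tagged q).+1 :> nat))
  end.

Definition in_T (m : nat) (V : finType) (h : rel V) (k0 : V) : Prop :=
  exists (s : 'I_m -> nat) (phi : V -> spider_vertex s),
    graph_iso h (@spider_adj m s) phi /\ phi k0 = None.

Definition add_edge (V : finType) (h : rel V) (u v : V) : rel V :=
  fun x y => [|| h x y, (x == u) && (y == v) | (x == v) && (y == u)].

Definition obtained_by_adding_edge (V : finType) (e h : rel V) (u v : V) :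
    Prop :=
  [/\ u != v, ~~ h u v & e =2 add_edge h u v].

Definition form_a (V : finType) (e : rel V) : Prop :=
  exists (m : nat) (h : rel V) (k0 v : V),
    [/\ (2 <= m)%N, in_T m h k0, pendant h v &
        obtained_by_adding_edge e h v k0].

Definition form_b (V : finType) (e : rel V) : Prop :=
  exists (m : nat) (h : rel V) (k0 v : V),
    [/\ (2 <= m)%N, in_T m h k0, internal h v &
        obtained_by_adding_edge e h k0 v].

Definition cycle_adj (n : nat) : rel 'I_n :=
  fun i j => (j == ordS i) || (i == ordS j).

Definition form_c (n : nat) (e : rel 'I_n) : Prop :=
  (3 <= n)%N /\ exists phi : 'I_n -> 'I_n, graph_iso e (@cycle_adj n) phi.

(* Main.v *)
From HB Require Import structures.
Require Import Defs.
From mathcomp Require Import all_boot all_order all_algebra.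
From mathcomp Require Import ring zify.

(* Write J(S, e) for the ideal generated by the variables of the vertices in S
   and by the edge-binomials of e. If v is not in S, then J(S, e) is the
   intersection of J(S, e_v) and J(S + v, e), where e_v completes the
   neighbourhood of v. Iterating this at vertices with two non-adjacent
   neighbours, until all components are complete, writes J(S, e) as an
   intersection of primes, each the kernel of an explicit substitution. Hence
   J : pq = J : q as soon as every prime of the decomposition containing p
   contains q; in particular J : q^2 = J : q for every q.

   The graphs (a), (b), (c) are those with an edge k0z for which H = G - k0z is
   a tree whose vertices other than k0 have degree at most 2. For such a graph,
   the edges of H off k0, then the edges of H at k0, then k0z form a d-sequence:
   a prime of the decomposition for a subforest of H that contains the binomial
   of a further edge of H contains the variables of an end of that edge with two
   earlier neighbours; this end is k0, and all later edges meet k0. Since H is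
   bipartite, exchanging x_v and y_v on one colour class turns its
   edge-binomials into its parity edge-binomials, and of the last element of the
   sequence only its membership in (x_k0, y_k0) matters.

   Conversely, the last edge pq of a d-sequence closes the cycle. Suppose that an
   edge at v comes after two edges va and vb, and let S contain v but neither a
   nor b. Then every later edge meets S or has its ends connected, by the edges
   before the one at v, outside S. Taking for S the vertex v alone, or v and a
   vertex of the path from p to q in G - pq, one finds that at most one vertex
   has degree at least 3 in G - pq, and that it is p or q. *)

Set Implicit Arguments.
Unset Strict Implicit.
Unset Printing Implicit Defensive.

(** * Graphs *)

Section Graphs.
Variable V : finType.
Implicit Types (e h K : rel V) (S : {set V}).

Definition restr S e : rel V := [rel a b | [&& e a b, a \notin S & b \notin S]].

Definition del_edge h (u w : V) : rel V :=
  [rel a b | h a b && ([set a; b] != [set u; w])].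

Definition acyclic h : Prop := forall u w, h u w -> ~~ connect (del_edge h u w) u w.

(** Degree at most 2, in pigeonhole form to avoid cardinals. *)
Definition few_nbrs h (v : V) : Prop :=
  forall a b c, h v a -> h v b -> h v c -> [|| a == b, a == c | b == c].

Record center_plus_edge e h (k0 z : V) : Prop := CenterPlusEdge {
  cpe_sym : symmetric h;
  cpe_acyclic : acyclic h;
  cpe_few : forall v, v != k0 -> few_nbrs h v;
  cpe_neq : k0 != z;
  cpe_nadj : ~~ h k0 z;
  cpe_edge : e =2 add_edge h k0 z }.

Lemma restr_sym S e : symmetric e -> symmetric (restr S e).
Proof. by move=> es a b; rewrite /restr /= es; congr (_ && _); rewrite andbC. Qed.

Lemma del_edge_sym h u w : symmetric h -> symmetric (del_edge h u w).
Proof. by move=> hs a b; rewrite /del_edge /= hs setUC. Qed.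

Lemma connect_const (r : rel V) (U : Type) (g : V -> U) a b :
  (forall w w', r w w' -> g w = g w') -> connect r a b -> g a = g b.
Proof.
move=> gE /connectP [p]; elim: p a => [|a1 p IH] a /=; first by move=> _ ->.
by case/andP=> /gE -> /IH.
Qed.

Lemma connect_mono (r r' : rel V) : subrel r r' -> subrel (connect r) (connect r').
Proof. by move=> rr'; apply: connect_sub => a b /rr'; apply: connect1. Qed.

Lemma connect_uniq (r : rel V) a b : connect r a b ->
  exists s, [/\ path r a s, uniq (a :: s) & b = last a s].
Proof.
case/connectP=> s rs ->; case: (shortenP rs) => s' rs' us' _.
by exists s'.
Qed.

Lemma set2_eq (a b c d : V) :
  [set a; b] = [set c; d] -> (a = c /\ b = d) \/ (a = d /\ b = c).
Proof.
move=> /setP E.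
have := E a; have := E b; have := E c; have := E d; rewrite !inE !eqxx ?orbT /=.
move=> /orP[]/eqP ? /orP[]/eqP ? /esym/orP[]/eqP ? /esym/orP[]/eqP ?; subst;
  by [left | right].
Qed.

Lemma few_nbrsVbranch h v : few_nbrs h v \/
  exists a b c, [/\ h v a, h v b, h v c & [/\ a != b, a != c & b != c]].
Proof.
have [/existsP[a /existsP[b /existsP[c]]]|] := boolP [exists a, exists b, exists c,
    [&& h v a, h v b, h v c, a != b, a != c & b != c]].
  by case/and5P=> va vb vc ab /andP[ac bc]; right; exists a, b, c.
rewrite negb_exists => /forallP H; left=> a b c va vb vc; apply: contraNT (H a).
rewrite !negb_or => /and3P[ab ac bc]; apply/existsP; exists b.
by apply/existsP; exists c; rewrite va vb vc ab ac bc.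
Qed.

(** A walk from [a] to [b] avoiding [v], entered through the edge from [v] to [b], would bypass the
    edge from [v] to [a]. *)
Lemma acyclic_sep h S v a b : symmetric h -> acyclic h ->
  h v a -> h v b -> a != b -> v \in S -> ~~ connect (restr S h) a b.
Proof.
move=> hs ha va vb ab vS; apply: contraNN (ha _ _ va) => con.
have sym := sym_connect_sym (del_edge_sym v a hs).
apply: (@connect_trans _ _ b).
  apply: connect1; rewrite /del_edge /= vb; apply: contraNneq ab => /set2_eq.
  by case=> [[_ ->]|[-> ->]].
rewrite sym; apply: connect_mono con => w w' /and3P[ww' wS w'S].
rewrite /del_edge /= ww'; apply: contraTneq vS => /set2_eq.
by case=> [[<- _]|[_ <-]].
Qed.

(** In a forest every vertex strictly inside the path from [p] to [q] separates them; [c] is the one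
    next to [p]. A walk from [p] to [q] avoiding [c], continued back along the path to [c], would
    bypass the edge from [p] to [c]. *)
Lemma interior_vertex h K p q : symmetric h -> irreflexive h -> acyclic h ->
  subrel K h -> connect K p q -> p != q -> ~~ h p q ->
  exists c c2, [/\ K p c, K c c2, p != c2, c != q & ~~ connect (restr [set c] h) p q].
Proof.
move=> hs hi ha Kh /connect_uniq [[|c [|c2 s]] [/= pth us ql]] pq hpq.
- by rewrite ql eqxx in pq.
- by rewrite andbT in pth; rewrite ql (Kh _ _ pth) in hpq.
case/and3P: pth us => pc cc2 pth /andP[pns /andP[cns us]].
exists c, c2; split=> //.
- by apply: contraNneq pns => ->; rewrite !inE eqxx orbT.
- by apply: contraNneq cns => ->; rewrite ql mem_last.
apply: contraNN (ha _ _ (Kh _ _ pc)) => con.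
have sym := sym_connect_sym (del_edge_sym p c hs).
apply: (@connect_trans _ _ q).
  apply: connect_mono con => w w' /and3P[ww' wS w'S].
  rewrite /del_edge /= ww'; apply/negP => /eqP /set2_eq.
  by case=> [[_ E]|[E _]]; [rewrite E inE eqxx in w'S | rewrite E inE eqxx in wS].
rewrite sym; apply/connectP; exists (c2 :: s); last by [].
apply: (@sub_in_path _ (predC1 p) K).
- move=> w w'; rewrite !inE => wp w'p /Kh ww'; rewrite /del_edge /= ww'.
  by apply: contraNneq wp => /set2_eq [[->]|[_ E]] //; rewrite E eqxx in w'p.
- by apply/allP => w ws /=; apply: contraNneq pns => <-.
- by rewrite /= cc2.
Qed.

(** The cycle is a [K]-path closed by the edge from [q] to [p]. The last clause, that all its other
    edges come from [K], serves to tell two such cycles apart. *)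
Lemma ucycle_of_path e K p q : symmetric e -> irreflexive e -> subrel K e ->
  e p q -> ~~ K p q -> connect K p q ->
  exists C, [/\ is_cycle_subgraph e C, [set p; q] \in C.2 &
    forall a b, [set a; b] \in C.2 -> K a b \/ K b a \/ [set a; b] = [set p; q]].
Proof.
move=> es ei Ke epq nK /connect_uniq [s [pth us ql]].
have s2 : (2 <= size s)%N.
  case: s pth us ql => [|c [|c2 s]] //= pth _ ql; first by rewrite ql ei in epq.
  by rewrite andbT in pth; rewrite ql pth in nK.
pose c := p :: s; pose r := [rel a b | K a b || (a == q) && (b == p)].
have cr : cycle r c.
  rewrite /c /= rcons_path -ql /= !eqxx orbT andbT.
  by apply: sub_path pth => a b ab; rewrite /= ab.
exists ([set x in c], [set [set x; next c x] | x in c]); split.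
- exists c; split=> //; apply/andP; split=> //.
  apply: sub_cycle cr => a b /= /orP[/Ke //|/andP[/eqP-> /eqP->]].
  by rewrite es.
- have qc : q \in c by rewrite /c ql mem_last.
  apply/imsetP; exists q => //.
  by rewrite next_nth qc /c ql index_last // nth_default // setUC.
- move=> a b /imsetP[w wc E].
  have := next_cycle cr wc => /orP[ww'|/andP[/eqP wq /eqP w'p]].
    by case: (set2_eq E) => -[-> ->]; [left | right; left].
  by right; right; rewrite E w'p wq setUC.
Qed.

(** Each of the two edges closes a cycle with a [K]-path. The first cycle contains the edge [p q],
    the second has only edges of [K] and [u w], so they differ. *)
Lemma unicyclic_two_edges e K p q u w : symmetric e -> irreflexive e ->
  unicyclic e -> symmetric K -> subrel K e ->
  e p q -> e u w -> [set p; q] <> [set u; w] ->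
  ~~ K p q -> ~~ K u w -> connect K p q -> connect K u w -> False.
Proof.
move=> es ei [C0 [_ uC]] Ks Ke epq euw ne nK nK' con con'.
have [C [CC pC _]] := ucycle_of_path es ei Ke epq nK con.
have [C' [CC' _ C'E]] := ucycle_of_path es ei Ke euw nK' con'.
have E : C = C' by rewrite -(uC _ CC) -(uC _ CC').
rewrite E in pC; case: (C'E _ _ pC) => [H|[H|//]]; case/negP: nK => //.
by rewrite Ks.
Qed.

End Graphs.

(** * Trees with a center *)

Section Coordinates.
Variables (V : finType) (I : eqType).
Implicit Types (h : rel V) (lg : V -> I) (dp : V -> nat).

(** [a] is the parent of [b]. The root counts as a member of every leg, whatever value [lg] takes
    there. *)
Definition up lg dp : rel V :=
  [rel a b | (dp b == (dp a).+1) && ((dp a == 0) || (lg a == lg b))].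

(* A tree with a single vertex of depth 0 in which the vertices of positive
   depth are determined by a leg and a depth. *)
Record coords h lg dp : Prop := Coords {
  coords_adj : forall a b, h a b = up lg dp a b || up lg dp b a;
  coords_root : forall a b, dp a = 0 -> dp b = 0 -> a = b;
  coords_inj : forall a b, dp a = dp b -> lg a = lg b -> a = b }.

Section Consequences.
Variables (h : rel V) (lg : V -> I) (dp : V -> nat).
Hypothesis C : coords h lg dp.

Lemma coords_sym : symmetric h.
Proof. by move=> a b; rewrite !(coords_adj C) orbC. Qed.

Lemma coords_col a b : h a b -> odd (dp a) != odd (dp b).
Proof.
rewrite (coords_adj C) => /orP[] /andP[/eqP -> _] /=; by case: (odd _).
Qed.

Lemma up_unique a a' b : up lg dp a b -> up lg dp a' b -> a = a'.
Proof.
case/andP=> /eqP E lgE /andP[/eqP E' lgE'].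
have da : dp a = dp a' by lia.
move: lgE lgE'; rewrite -da; case: eqP => /= [d0 _ _|_ /eqP <- /eqP E2].
  by apply: (coords_root C) => //; rewrite -da.
exact: (coords_inj C).
Qed.

Lemma down_unique a b b' : dp a != 0 -> up lg dp a b -> up lg dp a b' -> b = b'.
Proof.
move=> /negPf d0 /andP[/eqP E lgE] /andP[/eqP E' lgE']; move: lgE lgE'.
rewrite d0 /= => /eqP E1 /eqP E2.
by apply: (coords_inj C); rewrite ?E ?E' // -E1 -E2.
Qed.

Lemma coords_few v : dp v != 0 -> few_nbrs h v.
Proof.
move=> dv a b c; rewrite !(coords_adj C) => /orP[va|va] /orP[vb|vb] /orP[vc|vc];
  try by rewrite (down_unique dv va vb) eqxx.
all: try by rewrite (down_unique dv va vc) eqxx orbT.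
all: try by rewrite (down_unique dv vb vc) eqxx !orbT.
all: try by rewrite (up_unique va vb) eqxx.
all: try by rewrite (up_unique va vc) eqxx orbT.
by rewrite (up_unique vb vc) eqxx !orbT.
Qed.

(* Deleting the edge from u up to w cuts off the vertices of the leg of w that
   are at least as deep as w. *)
Lemma coords_acyclic : acyclic h.
Proof.
have cut u w : up lg dp u w -> ~~ connect (del_edge h u w) u w.
  move=> uw; have /andP[/eqP dw lgw] := uw.
  pose D x := (lg x == lg w) && (dp w <= dp x).
  have DE a b : up lg dp a b -> [set a; b] != [set u; w] -> D a = D b.
    move=> ab ne; have /andP[/eqP db lgb] := ab.
    have [da0|da0] := eqVneq (dp a) 0.
      have Da : D a = false by rewrite /D; lia.
      rewrite Da; apply/esym/negbTE; apply: contra ne => /andP[/eqP E le].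
      have bw : b = w by apply: (coords_inj C) => //; lia.
      by rewrite bw in ab *; rewrite (up_unique ab uw).
    move: lgb; rewrite (negPf da0) /= /D => /eqP ->.
    case: eqP => //= E; apply/idP/idP => [|le]; first by lia.
    rewrite leqNgt; apply: contra ne => lt.
    have bw : b = w by apply: (coords_inj C) => //; lia.
    by rewrite bw in ab *; rewrite (up_unique ab uw).
  apply/negP => con; have : D u = D w.
    apply: connect_const con => a b /andP[]; rewrite (coords_adj C).
    case/orP=> [ab ne|ba ne]; first exact: DE.
    by apply/esym/DE; rewrite // setUC.
  rewrite /D eqxx leqnn; lia.
move=> u w; rewrite (coords_adj C) => /orP[/cut //|/cut].
apply: contraNN; rewrite (sym_connect_sym (del_edge_sym u w coords_sym)).
by apply: connect_mono => a b; rewrite /del_edge /= [[set u; w]]setUC.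
Qed.

End Consequences.
End Coordinates.

(** * From the forms (a), (b), (c) to a tree with a center *)

Section FormsToCoordinates.

Definition spider_leg m (s : 'I_m -> nat) (v : spider_vertex s) : option 'I_m :=
  if v is Some p then Some (tag p) else None.

Definition spider_depth m (s : 'I_m -> nat) (v : spider_vertex s) : nat :=
  if v is Some p then (tagged p : nat).+1 else 0.

Lemma spider_vertex_inj m (s : 'I_m -> nat) (u v : spider_vertex s) :
  spider_leg u = spider_leg v -> spider_depth u = spider_depth v -> u = v.
Proof.
case: u v => [[i j]|] [[i' j']|] //= [E]; case: i' / E j' => j' [E].
by rewrite (val_inj E : j = j').
Qed.

Lemma spider_adjE m (s : 'I_m -> nat) (u v : spider_vertex s) :
  spider_adj u v = up (@spider_leg m s) (@spider_depth m s) u v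
                || up (@spider_leg m s) (@spider_depth m s) v u.
Proof.
case: u v => [[i j]|] [[i' j']|] //=; rewrite /up /= ?eqSS ?orbF ?andbF ?andbT //.
by rewrite !(inj_eq Some_inj) [i' == i]eq_sym -andb_orl andbC.
Qed.

Lemma in_T_coords m (V : finType) (h : rel V) (k0 : V) : in_T m h k0 ->
  exists I : eqType, exists (lg : V -> I) dp,
    coords h lg dp /\ forall v, (dp v == 0) = (v == k0).
Proof.
case=> s [phi [[/bij_inj phi_inj phiE] phi0]].
exists _, (fun v => spider_leg (phi v)), (fun v => spider_depth (phi v)); split.
  split=> [a b|a b|a b da lg]; first by rewrite -phiE spider_adjE.
    move=> da db; apply: phi_inj; apply: spider_vertex_inj; last by rewrite da db.
    by case: (phi a) (phi b) da db => [?|] [?|].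
  exact/phi_inj/spider_vertex_inj.
move=> v; apply/idP/eqP => [|->]; last by rewrite phi0.
by case E: (phi v) => [?|] // _; apply: phi_inj; rewrite phi0.
Qed.

(** The cycle without modular arithmetic: the path 0, ..., n-1 and the edge joining its ends. *)
Lemma cycle_adjE n (i j : 'I_n) : cycle_adj i j =
  [|| j == i.+1 :> nat, i == j.+1 :> nat,
      (i == 0 :> nat) && (j == n.-1 :> nat) | (j == 0 :> nat) && (i == n.-1 :> nat)].
Proof.
have ordSE (a b : 'I_n) : (b == ordS a) =
    (b == a.+1 :> nat) || ((a == n.-1 :> nat) && (b == 0 :> nat)).
  rewrite -val_eqE /=; have an := ltn_ord a; have bn := ltn_ord b.
  case: (ltngtP a.+1 n) => [lt|gt|E]; last by rewrite E modnn; lia.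
    by rewrite modn_small //; lia.
  lia.
rewrite /cycle_adj !ordSE; lia.
Qed.

End FormsToCoordinates.

Section FormsGood.
Variable n : nat.
Implicit Types (e : rel 'I_n).

(** The colouring is a bipartition of [h], needed for the passage to parity edge-binomials. *)
Definition colored_center e : Prop := exists h k0 z (col : 'I_n -> bool),
  center_plus_edge e h k0 z /\ forall u v, h u v -> col u != col v.

Lemma coords_center (I : eqType) (lg : 'I_n -> I) dp h k0 z e :
  coords h lg dp -> (forall v, (dp v == 0) = (v == k0)) ->
  k0 != z -> ~~ h k0 z -> e =2 add_edge h k0 z -> colored_center e.
Proof.
move=> C d0 k0z nh eE; exists h, k0, z, (odd \o dp).
split; [split=> // | exact: coords_col C].
- exact: coords_sym C.
- exact: coords_acyclic C.
- by move=> v vk; apply: (coords_few C); rewrite d0.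
Qed.

Lemma forms_center e : [\/ form_a e, form_b e | form_c e] -> colored_center e.
Proof.
case=> [[m [h [k0 [v [_ T _ [vk nh eE]]]]]]|[m [h [k0 [v [_ T _ [vk nh eE]]]]]]|].
- have [I [lg [dp [C d0]]]] := in_T_coords T.
  apply: (coords_center C d0 (z := v)); first by rewrite eq_sym.
    by rewrite (coords_sym C).
  by move=> a b; rewrite eE /add_edge; congr (_ || _); rewrite orbC.
- have [I [lg [dp [C d0]]]] := in_T_coords T.
  exact: (coords_center C d0 vk).
case=> n3 [phi [phi_bij phiE]]; have phi_inj := bij_inj phi_bij.
have [psi phiK psiK] := phi_bij.
have n0 : 0 < n by lia.
have n1 : n.-1 < n by lia.
(* The cycle is cut at the edge between the labels 0 and n-1. What remains is a path rooted at one
   of its ends, hence a single leg. *)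
pose k0 := psi (Ordinal n0); pose z := psi (Ordinal n1).
pose dp v : nat := phi v.
pose lg (v : 'I_n) := tt.
pose h : rel 'I_n := [rel a b | up lg dp a b || up lg dp b a].
have hE a b : h a b = (dp b == (dp a).+1) || (dp a == (dp b).+1).
  by rewrite /h /up /= eqxx !orbT !andbT.
have dpE a w : (dp a == phi w) = (a == w).
  by rewrite /dp (inj_eq val_inj) (inj_eq phi_inj).
have C : coords h lg dp.
  by split=> // a b; [move=> a0 b0|move=> da _]; apply: phi_inj; apply: val_inj;
     rewrite /= -/(dp a) -/(dp b) ?a0 ?b0.
have phik : phi k0 = 0 :> nat by rewrite psiK.
have phiz : phi z = n.-1 :> nat by rewrite psiK.
apply: (coords_center C (k0 := k0) (z := z)).
- by move=> v; rewrite -dpE phik.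
- rewrite -dpE phiz /dp phik; lia.
- rewrite hE /dp phik phiz; lia.
- move=> a b; rewrite -phiE cycle_adjE /add_edge hE -!dpE phik phiz -/(dp a) -/(dp b).
  by rewrite -!orbA [(dp b == 0) && _]andbC.
Qed.

End FormsGood.

(** * Coordinates on a tree: distance to the center and leg *)

Section TreeCoordinates.
Variables (V : finType) (h : rel V) (k0 : V).
Hypotheses (h_sym : symmetric h) (h_irr : irreflexive h) (h_acyclic : acyclic h).
Hypothesis h_conn : forall v, connect h k0 v.

Definition ball d : {set V} :=
  iter d (fun A => A :|: [set b | [exists a in A, h a b]]) [set k0].

Lemma ballS d b : (b \in ball d.+1) = (b \in ball d) || [exists a in ball d, h a b].
Proof. by rewrite /= !inE. Qed.

Lemma ball_exists v : exists d, v \in ball d.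
Proof.
have /connectP [p] := h_conn v; elim/last_ind: p v => [|p w IH] v /=.
  by move=> _ ->; exists 0; rewrite inE.
rewrite rcons_path last_rcons => /andP[hp hw] ->.
have [d dp] := IH _ hp erefl; exists d.+1; rewrite ballS; apply/orP; right.
by apply/existsP; exists (last k0 p); rewrite dp.
Qed.

Definition dist v : nat := ex_minn (ball_exists v).

Lemma ball_dist d v : (v \in ball d) = (dist v <= d).
Proof.
rewrite /dist; case: ex_minnP => m vm min; apply/idP/idP => [/min //|].
by elim: d {min} => [|d IH]; rewrite leq_eqVlt => /orP[/eqP <- //|] //;
  rewrite ltnS => /IH vd; rewrite ballS vd.
Qed.

Lemma dist0 v : (dist v == 0) = (v == k0).
Proof. by rewrite -leqn0 -ball_dist inE. Qed.

Lemma dist_step a b : h a b -> dist b <= (dist a).+1.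
Proof.
move=> ab; rewrite -ball_dist ballS; apply/orP; right.
by apply/existsP; exists a; rewrite ball_dist leqnn.
Qed.

Lemma dist_parent v : v != k0 -> exists2 w, h w v & dist v = (dist w).+1.
Proof.
rewrite -dist0; case E: (dist v) => [|d] // _.
have : v \in ball d.+1 by rewrite ball_dist E.
rewrite ballS ball_dist E ltnn /= => /existsP [w /andP[]].
rewrite ball_dist => wd wv; exists w => //.
by have := dist_step wv; rewrite E; lia.
Qed.

(** Parents are strictly nearer to [k0], so the descent from [v] never meets another vertex at least
    as far away as [v]. *)
Lemma connect_avoid x v : dist v <= dist x -> v != x ->
  connect (restr [set x] h) k0 v.
Proof.
have [d] := ubnP (dist v); elim: d v => // d IH v; rewrite ltnS => vd vx nvx.
have [->|vk] := eqVneq v k0; first exact: connect0.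
have [w wv E] := dist_parent vk.
have wx : w != x by apply: contraTneq vx => <-; rewrite -ltnNge E.
apply: (@connect_trans _ _ w); first by apply: IH => //; lia.
by apply: connect1; rewrite /restr /= wv !inE wx.
Qed.

(** If both ends were equally far from [k0], each would be reached from it without passing through
    the other, so the edge could be bypassed. *)
Lemma dist_adj_neq v w : h v w -> dist v != dist w.
Proof.
move=> vw; apply/eqP => E.
have vNw : v != w by apply: contraTneq vw => ->; rewrite h_irr.
have sub (S : {set V}) : (v \in S) || (w \in S) -> subrel (restr S h) (del_edge h v w).
  move=> vwS a b /and3P[ab aS bS]; rewrite /del_edge /= ab.
  by apply: contraTneq vwS => /set2_eq [[<- <-]|[<- <-]]; rewrite negb_or ?aS ?bS.
have := h_acyclic vw; case/negP; apply: (@connect_trans _ _ k0).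
  rewrite (sym_connect_sym (del_edge_sym v w h_sym)).
  apply: connect_mono (connect_avoid (x := w) _ vNw); last by rewrite E.
  by apply: sub; rewrite set11 orbT.
apply: connect_mono (connect_avoid (x := v) _ _); first by apply: sub; rewrite set11.
  by rewrite E.
by rewrite eq_sym.
Qed.

Lemma dist_adj v w : h v w -> dist w = (dist v).+1 \/ dist v = (dist w).+1.
Proof.
move=> vw; have := dist_step vw; have := dist_adj_neq vw.
by rewrite h_sym in vw; have := dist_step vw; lia.
Qed.

Definition leg v : V := fingraph.root (restr [set k0] h) v.

Let leg_connect a b : (leg a == leg b) = connect (restr [set k0] h) a b.
Proof. exact: (root_connect (sym_connect_sym (restr_sym _ h_sym))). Qed.

Lemma leg_adj a b : h a b -> a != k0 -> b != k0 -> leg a = leg b.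
Proof.
move=> ab ak bk; apply/eqP; rewrite leg_connect; apply: connect1.
by rewrite /restr /= ab !inE ak.
Qed.

Hypothesis h_few : forall v, v != k0 -> few_nbrs h v.

(** Induction on the distance. At distance 1 both vertices are neighbours of [k0], and [acyclic_sep]
    puts distinct neighbours into distinct legs. Further out the parents agree by induction, and the
    common parent has its own parent as a neighbour, which leaves room for one child only. *)
Lemma leg_dist_inj a b : dist a = dist b -> leg a = leg b -> a = b.
Proof.
move Ed: (dist a) => d; elim: d a b Ed => [|d IH] a b Ea Eb lab.
  by move/eqP: Ea; move/esym/eqP: Eb; rewrite !dist0 => /eqP-> /eqP->.
have ak : a != k0 by rewrite -dist0 Ea.
have bk : b != k0 by rewrite -dist0 -Eb.
have [a' aa' Ea'] := dist_parent ak; have [b' bb' Eb'] := dist_parent bk.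
have da' : dist a' = d by lia.
have db' : d = dist b' by lia.
have [d0|dn0] := posnP d.
  have a'k : a' = k0 by apply/eqP; rewrite -dist0 da' d0.
  have b'k : b' = k0 by apply/eqP; rewrite -dist0 -db' d0.
  rewrite a'k in aa'; rewrite b'k in bb'.
  apply/eqP; apply: contraT => ab.
  case/negP: (acyclic_sep h_sym h_acyclic aa' bb' ab (set11 k0)).
  by rewrite -leg_connect lab.
have a'k : a' != k0 by rewrite -dist0 da' -lt0n.
have b'k : b' != k0 by rewrite -dist0 -db' -lt0n.
have E : a' = b' by apply: IH => //; rewrite (leg_adj aa') // (leg_adj bb').
rewrite -E in bb'; have [w wa' Ew] := dist_parent a'k; rewrite h_sym in wa'.
case/or3P: (h_few a'k aa' bb' wa') => /eqP // Eq.
  by move: Ew; rewrite -Eq; lia.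
by move: Ew; rewrite -Eq; lia.
Qed.

Lemma tree_coords : coords h leg dist.
Proof.
have upE a b : h a b -> dist b = (dist a).+1 -> up leg dist a b.
  move=> ab E; rewrite /up /= E eqxx /= dist0; case: eqP => //= /eqP ak.
  apply/eqP/leg_adj => //; by rewrite -dist0 E.
have hE a b : up leg dist a b -> h a b.
  case/andP=> /eqP E lg; have bk : b != k0 by rewrite -dist0 E.
  have [w wb Ew] := dist_parent bk; suff -> : a = w by [].
  have dE : dist a = dist w by lia.
  move: lg; rewrite dist0 => /orP[ak|/eqP lg].
    have wk : w == k0 by rewrite -dist0 -dE dist0.
    by rewrite (eqP ak) (eqP wk).
  have [ak|ak] := eqVneq a k0.
    have wk : w == k0 by rewrite -dist0 -dE dist0 ak.
    by rewrite ak (eqP wk).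
  by apply: leg_dist_inj; rewrite // lg (leg_adj wb) // -dist0 -dE dist0.
split=> [a b|a b a0 b0|]; last exact: leg_dist_inj.
  apply/idP/orP => [ab|[/hE //|/hE]]; last by rewrite h_sym.
  have := dist_adj ab; case=> E; [left; exact: upE | right; apply: upE => //].
  by rewrite h_sym.
by move/eqP: a0; move/eqP: b0; rewrite !dist0 => /eqP -> /eqP ->.
Qed.

Lemma dist_down v j : 0 < j <= dist v -> exists2 w, dist w = j & leg w = leg v.
Proof.
move Ed: (dist v) => d; elim: d v Ed => [|d IH] v Ev jd; first by lia.
have [->|jv] := eqVneq j d.+1; first by exists v.
have vk : v != k0 by rewrite -dist0 Ev.
have [w wv Ew] := dist_parent vk.
have [||u du lu] := IH w; [by lia | by lia |].
exists u => //; rewrite lu (leg_adj wv) // -dist0; lia.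
Qed.

Lemma adj_center v : h k0 v = (dist v == 1).
Proof.
have k00 : dist k0 = 0 by apply/eqP; rewrite dist0.
rewrite (coords_adj tree_coords) /up /= k00 /=; lia.
Qed.

Section Spider.
Let N := [set w | h k0 w].
Let m := #|N|.
Let center_leg (i : 'I_m) : V := enum_val i.
(** Greatest distance in the leg, minus one because leg [i] of a spider has [s i + 1] vertices. *)
Let s (i : 'I_m) : nat := \max_(v | leg v == leg (center_leg i)) (dist v).-1.

Let phi (v : V) : spider_vertex s :=
  if [pick i : 'I_m | (v != k0) && (leg v == leg (center_leg i))] is Some i
  then Some (existT (fun i => 'I_(s i).+1) i (inord (dist v).-1)) else None.

Let center_leg_adj i : h k0 (center_leg i).
Proof. by have := enum_valP i; rewrite inE. Qed.

Let center_leg_inj i i' : leg (center_leg i) = leg (center_leg i') -> i = i'.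
Proof.
move=> E; apply: enum_val_inj; apply: leg_dist_inj E.
by move: (center_leg_adj i) (center_leg_adj i'); rewrite !adj_center => /eqP-> /eqP->.
Qed.

Let phi_center : phi k0 = None.
Proof. by rewrite /phi; case: pickP => // i; rewrite eqxx. Qed.

Let phi_leg v : v != k0 -> exists i (j : 'I_(s i).+1),
  [/\ phi v = Some (existT (fun i => 'I_(s i).+1) i j), leg v = leg (center_leg i) &
      dist v = j.+1 :> nat].
Proof.
move=> vk; have dv : 0 < dist v by rewrite lt0n dist0.
rewrite /phi; case: pickP => [i /andP[_ /eqP lv]|none].
  exists i, (inord (dist v).-1); split=> //; rewrite inordK ?prednK //.
  rewrite -(prednK dv) ltnS /s.
  by apply: (@leq_bigmax_cond _ _ (fun v => (dist v).-1)); rewrite lv.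
have [|w w1 lw] := @dist_down v 1; first by rewrite dv.
have wN : w \in N by rewrite inE adj_center w1.
have := none (enum_rank_in wN w); rewrite vk /center_leg enum_rankK_in //.
by rewrite lw eqxx.
Qed.

Lemma tree_in_T : in_T (degree h k0) h k0.
Proof.
exists s, phi; split=> //.
have phi_inj : injective phi.
  move=> a b; have [->|ak] := eqVneq a k0; have [->|bk] := eqVneq b k0 => //.
  - by rewrite phi_center; have [i [j [-> _ _]]] := phi_leg bk.
  - by rewrite phi_center; have [i [j [-> _ _]]] := phi_leg ak.
  have [i [j [-> la da]]] := phi_leg ak; have [i' [j' [-> lb db]]] := phi_leg bk.
  move=> E; have [Ei] := congr1 (@spider_leg m s) E.
  have := congr1 (@spider_depth m s) E; rewrite /= -da -db => Ed.
  by apply: leg_dist_inj; rewrite // la lb Ei.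
have phi_surj w : exists v, phi v == w.
  case: w => [[i j]|]; last by exists k0; rewrite phi_center.
  have j_s := ltn_ord j.
  have [v lv dv] : exists2 v, leg v = leg (center_leg i) & j.+1 <= dist v.
    have [v0 lv0 sE] : {v0 | leg v0 == leg (center_leg i) & s i = (dist v0).-1}.
      by apply: eq_bigmax_cond; apply/card_gt0P; exists (center_leg i); apply: eqxx.
    (* Because of the truncated predecessor, a vertex attaining the maximum is known to have
       positive distance only if [s i] is positive. So for [j = 0] the neighbour of [k0] is used. *)
    have [j0|j0] := posnP j.
      exists (center_leg i) => //; rewrite j0.
      by move: (center_leg_adj i); rewrite adj_center => /eqP ->.
    by exists v0; [exact/eqP | lia].
  have [|w dw lw] := @dist_down v j.+1; first by rewrite dv.
  exists w; have wk : w != k0 by rewrite -dist0 dw.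
  have [i' [j' [-> lw' dw']]] := phi_leg wk.
  have E : i = i' by apply: center_leg_inj; rewrite -lv -lw.
  by apply/eqP/spider_vertex_inj; rewrite /= ?E // -dw' -dw.
split.
  exists (fun w => xchoose (phi_surj w)) => [v|w]; last exact/eqP/(xchooseP (phi_surj w)).
  by apply: phi_inj; apply/eqP/(xchooseP (phi_surj (phi v))).
move=> a b; rewrite (coords_adj tree_coords).
have k00 : dist k0 = 0 by apply/eqP; rewrite dist0.
have [->|ak] := eqVneq a k0; have [->|bk] := eqVneq b k0.
- by rewrite phi_center /up /= !k00.
- rewrite phi_center; have [i [j [-> lb db]]] := phi_leg bk.
  by rewrite /up /= k00 db; lia.
- rewrite phi_center; have [i [j [-> la da]]] := phi_leg ak.
  by rewrite /up /= k00 da; lia.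
have [i [j [-> la da]]] := phi_leg ak; have [i' [j' [-> lb db]]] := phi_leg bk.
rewrite /up /= da db la lb !eqSS /= [leg (_ i') == _]eq_sym -andb_orl andbC.
congr (_ && _); apply/eqP/eqP => [->//|]; exact: center_leg_inj.
Qed.

End Spider.

End TreeCoordinates.

Lemma degree_gt0 (V : finType) (h : rel V) a b :
  connect h a b -> a != b -> 0 < degree h a.
Proof.
case/connectP=> -[|w p] /=; first by move=> _ ->; rewrite eqxx.
by case/andP=> aw _ _ _; apply/card_gt0P; exists w; rewrite inE.
Qed.

Lemma degree1_unique (V : finType) (h : rel V) a b c :
  degree h a = 1 -> h a b -> h a c -> b = c.
Proof.
move=> /eqP/cards1P [w Nw] ab ac.
have : b \in [set w] by rewrite -Nw inE.
have : c \in [set w] by rewrite -Nw inE.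
by rewrite !inE => /eqP -> /eqP ->.
Qed.

(** A center of degree 1 leaves a single leg, so the distance alone labels the vertices by 0, ...,
    n-1, and [z], being the other end of the path, gets the label n-1. *)
Lemma path_plus_edge_cycle n (e h : rel 'I_n) k0 z :
  irreflexive h -> center_plus_edge e h k0 z -> (forall v, connect h k0 v) ->
  degree h k0 = 1 -> degree h z = 1 -> form_c e.
Proof.
move=> hi [hs ha hf k0z nh eE] hc dk dz.
have C := tree_coords hs hi ha hc hf.
pose d := dist hc; have d0 v : (d v == 0) = (v == k0) by apply: dist0.
have down v j : 0 < j <= d v -> exists2 w, d w = j & leg h k0 w = leg h k0 v.
  exact: dist_down.
have d_inj : injective d.
  move=> a b dab; have [ak|ak] := eqVneq a k0.
    by apply: (coords_root C); apply/eqP; rewrite -/(d _) -?dab d0 ak.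
  have bk : b != k0 by rewrite -d0 -dab d0.
  apply: (coords_inj C) => //.
  have [|wa wa1 <-] := down a 1.
    by move: ak; rewrite -d0; lia.
  have [|wb wb1 <-] := down b 1.
    by move: bk; rewrite -d0; lia.
  congr (leg _ _ _); apply: (degree1_unique dk);
    by rewrite (adj_center hs hi ha hc hf) -/(d _) ?wa1 ?wb1.
(* All distances from 0 to [d v] are attained, which gives [d v + 1] distinct vertices. *)
have dn v : d v < n.
  have ex (j : 'I_(d v).+1) : exists w, d w == j.
    case: j => [[|j] jd] /=; first by exists k0; rewrite d0.
    have [|w wj _] := down v j.+1.
      by lia.
    by exists w; apply/eqP.
  rewrite -[X in _ < X]card_ord -[X in X <= _]card_ord.
  apply: (leq_card (fun j => xchoose (ex j))) => i j E.
  apply: val_inj; rewrite /= -(eqP (xchooseP (ex i))) -(eqP (xchooseP (ex j))).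
  by rewrite E.
pose phi v := Ordinal (dn v).
have phi_inj : injective phi by move=> a b [] /d_inj.
have phi_bij : bijective phi := injF_bij phi_inj.
have hE a b : h a b = (d b == (d a).+1) || (d a == (d b).+1).
  rewrite (coords_adj C) /up /= -!/(d _).
  suff lE u w : d w == (d u).+1 -> (d u == 0) || (leg h k0 u == leg h k0 w).
    apply/orP/orP => [[/andP[H _]|/andP[H _]]|[H|H]]; [by left | by right | left | right];
    by rewrite H; apply: lE.
  move=> /eqP dw; rewrite d0; have [//|uk] := eqVneq u k0.
  have wk : w != k0 by rewrite -d0 dw.
  have [w' w'w E] := dist_parent hc wk.
  have -> : u = w' by apply: d_inj; move: E; rewrite -/(d w) -/(d w'); lia.
  apply/eqP/leg_adj => //; rewrite -d0; move: E; rewrite -/(d w) -/(d w') dw.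
  move=> [<-]; by rewrite d0.
(* Otherwise [z] would have both a parent and a child. *)
have dzn : d z = n.-1.
  have [//|nz] := eqVneq (d z) n.-1; exfalso.
  have zn : (d z).+1 < n by have := dn z; lia.
  have [psi _ psiK] := phi_bij; pose w := psi (Ordinal zn).
  have dw : d w = (d z).+1 by have /(congr1 val) := psiK (Ordinal zn).
  have zk : z != k0 by rewrite eq_sym.
  have [u uz du] := dist_parent hc zk.
  have zw : h z w by rewrite hE dw eqxx.
  rewrite hs in uz; have E := degree1_unique dz uz zw.
  by move: du; rewrite -!/(d _) E dw; lia.
have dk0 : d k0 = 0 by apply/eqP; rewrite d0.
have n3 : 2 < n.
  have dz0 : d z != 0 by rewrite d0 eq_sym.
  by move: nh dz0; rewrite hE dk0 dzn; lia.
split=> //; exists phi; split=> // a b.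
rewrite cycle_adjE eE /add_edge /= hE -!(inj_eq d_inj) dk0 dzn -!orbA.
by rewrite [(d b == 0) && _]andbC.
Qed.

Lemma center_forms n (e h : rel 'I_n) k0 z :
  irreflexive h -> center_plus_edge e h k0 z -> (forall a b, connect h a b) ->
  [\/ form_a e, form_b e | form_c e].
Proof.
move=> hi cpe hc; have [hs ha hf k0z nh eE] := cpe.
have dk : 0 < degree h k0 := degree_gt0 (hc _ _) k0z.
have zk0 : z != k0 by rewrite eq_sym.
have dz : 0 < degree h z := degree_gt0 (hc _ _) zk0.
have eE' : e =2 add_edge h z k0.
  by move=> a b; rewrite eE /add_edge; congr (_ || _); rewrite orbC.
have nh' : ~~ h z k0 by rewrite hs.
have [k2|k1] := leqP 2 (degree h k0).
  have T := tree_in_T hs hi ha (hc k0) hf.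
  have [z2|z1] := leqP 2 (degree h z).
    by apply: Or32; exists (degree h k0), h, k0, z.
  by apply: Or31; exists (degree h k0), h, k0, z; split=> //; rewrite /pendant; lia.
have dk1 : degree h k0 = 1 by lia.
have [z2|z1] := leqP 2 (degree h z).
  have hf' v : v != z -> few_nbrs h v.
    have [->|vk _] := eqVneq v k0; last exact: hf.
    by move=> _ a b c va vb _; rewrite (degree1_unique dk1 va vb) eqxx.
  have T := tree_in_T hs hi ha (hc z) hf'.
  by apply: Or31; exists (degree h z), h, z, k0.
by apply: Or33; apply: (path_plus_edge_cycle hi cpe (hc k0)) => //; lia.
Qed.

Import GRing.Theory.
Local Open Scope ring_scope.

(** * Ideals given by a predicate *)

Section Span.
Variable R : comNzRingType.
Implicit Types (P Q : R -> Prop) (x g c : R).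

(** A predicate allows infinite or undecidable sets of generators, and the inductive form gives
    induction on membership. *)
Inductive ideal_span P : R -> Prop :=
| ideal_span0 : ideal_span P 0
| ideal_spanMD c g x : P g -> ideal_span P x -> ideal_span P (c * g + x).

Lemma ideal_spanMl P c x : ideal_span P x -> ideal_span P (c * x).
Proof.
elim=> [|d g z Pg _ IH]; first by rewrite mulr0; apply: ideal_span0.
by rewrite mulrDr mulrA; apply: ideal_spanMD.
Qed.

Lemma ideal_spanMr P c x : ideal_span P x -> ideal_span P (x * c).
Proof. by rewrite mulrC; apply: ideal_spanMl. Qed.

Lemma ideal_spanN P x : ideal_span P x -> ideal_span P (- x).
Proof. by rewrite -mulN1r; apply: ideal_spanMl. Qed.

Lemma ideal_spanD P x z : ideal_span P x -> ideal_span P z -> ideal_span P (x + z).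
Proof.
move=> sx sz; elim: sx => [|d g w Pg _ IH]; first by rewrite add0r.
by rewrite -addrA; apply: ideal_spanMD.
Qed.

Lemma ideal_spanB P x z : ideal_span P x -> ideal_span P z -> ideal_span P (x - z).
Proof. by move=> sx sz; apply: ideal_spanD => //; apply: ideal_spanN. Qed.

Lemma ideal_span_gen P g : P g -> ideal_span P g.
Proof.
by move=> Pg; rewrite -[g]mul1r -[_ * g]addr0; apply: ideal_spanMD (ideal_span0 P).
Qed.

Lemma ideal_span_sum P (I : Type) (r : seq I) (B : pred I) (F : I -> R) :
  (forall i, B i -> ideal_span P (F i)) -> ideal_span P (\sum_(i <- r | B i) F i).
Proof. by move=> H; elim/big_ind: _ => //; [apply: ideal_span0 | apply: ideal_spanD]. Qed.

Lemma ideal_span_mono P Q x :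
  (forall g, P g -> ideal_span Q g) -> ideal_span P x -> ideal_span Q x.
Proof.
move=> sub; elim=> [|c g z Pg _ IH]; first exact: ideal_span0.
by apply: ideal_spanD => //; apply/ideal_spanMl/sub.
Qed.

Lemma gen_idealE (s : seq R) x : gen_ideal s x <-> ideal_span (fun g => g \in s) x.
Proof.
split=> [[c ->]|].
  by apply: ideal_span_sum => i _; apply/ideal_spanMl/ideal_span_gen/mem_nth.
elim=> [|d g z gs _ [c ->]].
  by exists (fun=> 0); rewrite big1 // => i _; rewrite mul0r.
have gi: (index g s < size s)%N by rewrite index_mem.
exists (fun i => (if i == Ordinal gi then d else 0) + c i).
under [RHS]eq_bigr do rewrite mulrDl.
rewrite big_split /=; congr (_ + _).
rewrite (bigD1 (Ordinal gi)) //= eqxx nth_index // big1 ?addr0 // => i /negPf ->.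
by rewrite mul0r.
Qed.

Lemma gen_ideal_cons0 (s : seq R) x :
  gen_ideal (0 :: s) x <-> ideal_span (fun g => g \in s) x.
Proof.
rewrite gen_idealE; split; apply: ideal_span_mono => g.
  by rewrite inE => /orP[/eqP->|gs]; [apply: ideal_span0 | apply: ideal_span_gen].
by move=> gs; apply: ideal_span_gen; rewrite inE gs orbT.
Qed.

End Span.

Lemma ideal_span_morph (R T : comNzRingType) (phi : {rmorphism R -> T})
    (P : R -> Prop) (Q : T -> Prop) x :
  (forall g, P g -> ideal_span Q (phi g)) -> ideal_span P x -> ideal_span Q (phi x).
Proof.
move=> H; elim=> [|c g z Pg _ IH]; first by rewrite rmorph0; apply: ideal_span0.
by rewrite rmorphD rmorphM; apply: ideal_spanD => //; apply/ideal_spanMl/H.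
Qed.

Lemma ideal_span_kill (R T : comNzRingType) (phi : {rmorphism R -> T})
    (P : R -> Prop) x :
  (forall g, P g -> phi g = 0) -> ideal_span P x -> phi x = 0.
Proof.
move=> H; elim=> [|c g z Pg _ IH]; first by rewrite rmorph0.
by rewrite rmorphD rmorphM IH (H _ Pg) mulr0 addr0.
Qed.

(** * Substitutions *)

Lemma mpoly_ring_ind (k : fieldType) (N : nat) (Q : {mpoly k[N]} -> Prop) :
  (forall c, Q c%:MP) -> (forall i, Q 'X_i) ->
  (forall p q, Q p -> Q q -> Q (p + q)) ->
  (forall p q, Q p -> Q q -> Q (p * q)) -> forall p, Q p.
Proof.
move=> QC QX QD QM p; rewrite (mpolyE p).
apply: (big_ind Q); [by rewrite -mpolyC0 | exact: QD | move=> m _].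
rewrite -mul_mpolyC; apply: (QM) => //.
rewrite mpolyXE_id; apply: (big_ind Q); [by rewrite -mpolyC1 | exact: QM | move=> i _].
by elim: (m i) => [|j IH]; rewrite ?expr0 -?mpolyC1 // exprS; apply: QM.
Qed.

Section Subst.
Variables (k : fieldType) (n : nat) (T : comNzRingType).
Variable iota : {rmorphism k -> T}.

Definition subst (hx hy : 'I_n -> T) : {mpoly k[n + n]} -> T :=
  mmap iota (fun i => match split i with inl v => hx v | inr v => hy v end).

HB.instance Definition _ hx hy := GRing.RMorphism.on (subst hx hy).

Lemma subst_x hx hy v : subst hx hy (xvar k v) = hx v.
Proof. by rewrite /subst mmapX mmap1U (unsplitK (inl v)). Qed.

Lemma subst_y hx hy v : subst hx hy (yvar k v) = hy v.
Proof. by rewrite /subst mmapX mmap1U (unsplitK (inr v)). Qed.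

Lemma subst_f hx hy a b :
  subst hx hy (edge_binomial k a b) = hx a * hy b - hx b * hy a.
Proof. by rewrite /edge_binomial rmorphB !rmorphM /= !subst_x !subst_y. Qed.

Lemma subst_g hx hy a b :
  subst hx hy (parity_edge_binomial k a b) = hx a * hx b - hy a * hy b.
Proof. by rewrite /parity_edge_binomial rmorphB !rmorphM /= !subst_x !subst_y. Qed.

Lemma subst_C hx hy c : subst hx hy c%:MP = iota c.
Proof. exact: mmapC. Qed.

End Subst.

(** * Binomial edge ideals *)

Section Components.
Variables (k : fieldType) (n : nat).
Local Notation V := 'I_n.
Local Notation R := {mpoly k[n + n]}.
Local Notation x := (@xvar k n).
Local Notation y := (@yvar k n).
Local Notation f := (@edge_binomial k n).
Implicit Types (S : {set V}) (e : rel V) (c : V -> V) (m : 'X_{1..n + n}).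

Definition bei_gen S e (g : R) : Prop :=
  (exists2 v, v \in S & g = x v \/ g = y v) \/
  (exists a b, e a b /\ g = f a b).

Definition bei S e : R -> Prop := ideal_span (bei_gen S e).

Lemma bei_x S e v : v \in S -> bei S e (x v).
Proof. by move=> vS; apply: ideal_span_gen; left; exists v => //; left. Qed.

Lemma bei_y S e v : v \in S -> bei S e (y v).
Proof. by move=> vS; apply: ideal_span_gen; left; exists v => //; right. Qed.

Lemma bei_f S e a b : e a b -> bei S e (f a b).
Proof. by move=> ab; apply: ideal_span_gen; right; exists a, b. Qed.

Lemma fxx a : f a a = 0.
Proof. by rewrite /edge_binomial subrr. Qed.

Lemma fC a b : f a b = - f b a.
Proof. by rewrite /edge_binomial opprB. Qed.

(* The kernel of [phi S c] is the prime generated by the variables of S and the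
   2-minors of the generic matrices on the fibres of c: on each fibre the row of
   the y_v becomes proportional to the row of the x_v, the variable [y (c v)]
   being reused as the factor of proportionality. *)
Definition phi S c : R -> R :=
  subst (@mpolyC (n + n) k)
    (fun v => if v \in S then 0 else x v)
    (fun v => if v \in S then 0 else y (c v) * x v).

HB.instance Definition _ S c := GRing.RMorphism.on (phi S c).

Lemma phi_x S c v : phi S c (x v) = if v \in S then 0 else x v.
Proof. exact: subst_x. Qed.

Lemma phi_y S c v : phi S c (y v) = if v \in S then 0 else y (c v) * x v.
Proof. exact: subst_y. Qed.

Lemma x_neq0 v : x v != 0.
Proof.
apply/eqP => /(congr1 (mcoeff U_(lshift n v))).
by rewrite mcoeffXU eqxx mcoeff0 => /eqP; rewrite oner_eq0.
Qed.

Lemma y_inj v w : y v = y w -> v = w.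
Proof.
move/(congr1 (mcoeff U_(rshift n v))); rewrite !mcoeffXU eqxx.
by case: eqP => [/rshift_inj-> //|_ /eqP]; rewrite oner_eq0.
Qed.

Lemma phi_f_eq0 S c a b :
  (phi S c (f a b) == 0) = [|| a \in S, b \in S | c a == c b].
Proof.
rewrite /phi subst_f; case: (a \in S); first by rewrite !(mul0r, mulr0) subrr eqxx.
case: (b \in S); first by rewrite !(mul0r, mulr0) subrr eqxx.
have -> : x a * (y (c b) * x b) - x b * (y (c a) * x a)
          = x a * x b * (y (c b) - y (c a)) by ring.
rewrite !mulf_eq0 !(negPf (x_neq0 _)) /= subr_eq0 eq_sym.
by apply/eqP/eqP => [/y_inj|->].
Qed.

Definition fib S c : rel V := [rel a b | [&& a \notin S, b \notin S & c a == c b]].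

Definition supp_off S m : bool :=
  [forall v in S, (m (lshift n v) == 0%N) && (m (rshift n v) == 0%N)].

(** The exponent of the image of a monomial under [phi]: it records the total degree at each vertex
    and the degree in the [y] variables on each fibre of [c]. *)
Definition phi_mon c m : 'X_{1..n + n} :=
  [multinom match split i with
            | inl v => (m (lshift n v) + m (rshift n v))%N
            | inr d => (\sum_(v | c v == d) m (rshift n v))%N
            end | i < n + n].

Lemma phi_mon_l c m v :
  phi_mon c m (lshift n v) = (m (lshift n v) + m (rshift n v))%N.
Proof. by rewrite mnmE (unsplitK (inl v)). Qed.

Lemma phi_mon_r c m d :
  phi_mon c m (rshift n d) = (\sum_(v | c v == d) m (rshift n v))%N.
Proof. by rewrite mnmE (unsplitK (inr d)). Qed.

Lemma phi_monD c m1 m2 : phi_mon c (m1 + m2) = (phi_mon c m1 + phi_mon c m2)%MM.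
Proof.
apply/mnmP => i; rewrite mnmDE; case: (splitP i) => j ij.
  have -> : i = lshift n j by apply: val_inj.
  by rewrite !phi_mon_l !mnmDE addnACA.
have -> : i = rshift n j by apply: val_inj.
by rewrite !phi_mon_r -big_split /=; apply: eq_bigr => v _; rewrite mnmDE.
Qed.

Lemma supp_offP S m :
  reflect (forall v, v \in S -> m (lshift n v) = 0%N /\ m (rshift n v) = 0%N)
          (supp_off S m).
Proof.
apply: (iffP forallP) => [H v vS|H v].
  by move: (H v); rewrite vS => /= /andP[/eqP-> /eqP->].
by apply/implyP => /H [-> ->].
Qed.

Lemma supp_offD S m1 m2 :
  supp_off S (m1 + m2)%MM = supp_off S m1 && supp_off S m2.
Proof.
apply/supp_offP/andP => [H|[/supp_offP H1 /supp_offP H2] v vS].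
  split; apply/supp_offP => v vS; have [] := H v vS; rewrite !mnmDE => /eqP;
  by rewrite addn_eq0 => /andP[/eqP ? /eqP ?] /eqP;
     rewrite addn_eq0 => /andP[/eqP ? /eqP ?].
by rewrite !mnmDE; have [-> ->] := H1 v vS; have [-> ->] := H2 v vS.
Qed.

Lemma prodX_split (F : 'I_(n + n) -> R) :
  \prod_i F i = \prod_v F (lshift n v) * \prod_v F (rshift n v).
Proof. exact: big_split_ord. Qed.

Lemma phi_X S c m :
  phi S c 'X_[m] = if supp_off S m then 'X_[phi_mon c m] else 0.
Proof.
rewrite mpolyXE_id rmorph_prod prodX_split.
under eq_bigr => v _ do rewrite rmorphXn /= phi_x.
under [X in _ * X]eq_bigr => v _ do rewrite rmorphXn /= phi_y.
case: ifPn => [/supp_offP off|].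
  have pow0 v (p : R) : (if v \in S then 0 else p) ^+ m (lshift n v) = p ^+ m (lshift n v)
     /\ (if v \in S then 0 else p) ^+ m (rshift n v) = p ^+ m (rshift n v).
    by case: ifP => // /off [-> ->]; rewrite !expr0.
  under eq_bigr => v _ do rewrite (pow0 v _).1.
  under [X in _ * X]eq_bigr => v _ do rewrite (pow0 v _).2 exprMn.
  rewrite big_split /= mulrCA -big_split /=.
  rewrite [RHS]mpolyXE_id prodX_split mulrC; congr (_ * _).
    by apply: eq_bigr => v _; rewrite phi_mon_l exprD.
  rewrite (partition_big c xpredT) //=; apply: eq_bigr => d _.
  by rewrite phi_mon_r expr_sum; apply: eq_bigr => v /eqP <-.
rewrite negb_forall => /existsP [v]; rewrite negb_imply negb_and => /andP[vS].
case/orP => nz; [rewrite (bigD1 v) //= | rewrite mulrC (bigD1 v) //=];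
  by rewrite vS expr0n (negPf nz) !mul0r.
Qed.

Lemma mnm_split_unit m i : (0 < m i)%N -> m = (U_(i) + (m - U_(i)))%MM.
Proof.
move=> mi; apply/mnmP => j; rewrite mnmDE mnmBE mnm1E.
by case: eqP => [<-|_] /=; rewrite ?subn0 // subnKC.
Qed.

Lemma addmI m m1 m2 : (m + m1 = m + m2)%MM -> m1 = m2.
Proof.
by move=> E; apply/mnmP => i; move/mnmP: E => /(_ i); rewrite !mnmDE => /addnI.
Qed.

Definition same_class S c m m' := bei S (fib S c) ('X_[m] - 'X_[m']).

(** Induction on the degree: a variable common to both monomials is cancelled, and if there is none,
    a 2-minor is used to create one. *)
Lemma same_classP S c m m' :
  supp_off S m -> supp_off S m' -> phi_mon c m = phi_mon c m' ->
  same_class S c m m'.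
Proof.
move: {2}(mdeg m).+1 (ltnSn (mdeg m)) => N.
elim: N m m' => // N IH m m'; rewrite ltnS => degm.
have cancel m1 m2 i : (mdeg m1 <= N)%N -> supp_off S m1 -> supp_off S m2 ->
    phi_mon c m1 = phi_mon c m2 -> (0 < m1 i)%N -> (0 < m2 i)%N ->
    same_class S c m1 m2.
  move=> deg1 off1 off2 E /mnm_split_unit E1 /mnm_split_unit E2.
  move: deg1 off1 off2 E; rewrite E1 E2 /same_class !mpolyXD -mulrBr.
  rewrite mdegD mdeg1 !supp_offD !phi_monD => deg1 /andP[_ o1] /andP[_ o2] /addmI E.
  by apply: ideal_spanMl; apply: IH.
(* Here [m1] contains [x v] and [m2] contains [y v]. The [y]-degrees on the fibre of [v] agree, so
   if [m1] lacks [y v] it contains some [y w] with [w] in that fibre. Exchanging x_v y_w for x_w y_v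
   modulo [f v w] gives [m4], which shares [y v] with [m2]. *)
have swap m1 m2 v : (mdeg m1 <= N)%N -> supp_off S m1 -> supp_off S m2 ->
    phi_mon c m1 = phi_mon c m2 -> (0 < m1 (lshift n v))%N ->
    (0 < m2 (rshift n v))%N -> same_class S c m1 m2.
  move=> deg1 off1 off2 E m1v m2v.
  have [m1v0|m1v0] := posnP (m1 (rshift n v)); last exact: cancel m1v0 m2v.
  have : (0 < \sum_(w | c w == c v) m1 (rshift n w))%N.
    rewrite -phi_mon_r E phi_mon_r (bigD1 v) //=.
    by apply: leq_trans m2v _; apply: leq_addr.
  rewrite lt0n sum_nat_eq0 negb_forall => /existsP [w].
  rewrite negb_imply -lt0n => /andP[/eqP cwv m1w].
  have vNw : v != w by apply: contraL m1w => /eqP <-; rewrite m1v0.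
  have m1w' : (0 < (m1 - U_(lshift n v))%MM (rshift n w))%N.
    by rewrite mnmBE mnm1E eq_lrshift subn0.
  have Em1 := mnm_split_unit m1v; rewrite (mnm_split_unit m1w') in Em1.
  move: Em1; set m3 := (_ - U_(rshift n w))%MM => Em1.
  pose m4 := (U_(lshift n w) + (U_(rshift n v) + m3))%MM.
  have offv : v \notin S.
    by apply: contraL m1v => /(supp_offP _ _ off1) [-> _].
  have offw : w \notin S.
    by apply: contraL m1w => /(supp_offP _ _ off1) [_ ->].
  have s14 : same_class S c m1 m4.
    rewrite /same_class Em1 !mpolyXD.
    have -> : 'X_(lshift n v) * ('X_(rshift n w) * 'X_[m3])
              - 'X_(lshift n w) * ('X_(rshift n v) * 'X_[m3])
              = 'X_[m3] * f v w by rewrite /edge_binomial /xvar /yvar; ring.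
    by apply/ideal_spanMl/bei_f; rewrite /fib /= offv offw cwv eqxx.
  have off3 : supp_off S m3.
    by move: off1; rewrite Em1 !supp_offD => /and3P[].
  have off4 : supp_off S m4.
    have offU z : z \notin S -> supp_off S U_(lshift n z) && supp_off S U_(rshift n z).
      move=> zS; apply/andP; split; apply/supp_offP => s sS;
      by rewrite !mnm1E ?eq_lrshift ?eq_rlshift ?(inj_eq (@lshift_inj _ _))
        ?(inj_eq (@rshift_inj _ _)); case: eqP sS zS => // <- ->.
    rewrite /m4 !supp_offD off3.
    by case/andP: (offU _ offw) => -> _; case/andP: (offU _ offv) => _ ->.
  have E4 : phi_mon c m4 = phi_mon c m1.
    rewrite Em1 /m4 !phi_monD !addmA; congr (_ + _)%MM.
    apply/mnmP => i; rewrite !mnmDE; case: (splitP i) => j ij.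
      have -> : i = lshift n j by apply: val_inj.
      rewrite !phi_mon_l !mnm1E !eq_lrshift !eq_rlshift.
      by rewrite !(inj_eq (@lshift_inj _ _)) !(inj_eq (@rshift_inj _ _)) !addn0 !add0n addnC.
    have -> : i = rshift n j by apply: val_inj.
    rewrite !phi_mon_r.
    have one z : (\sum_(a | c a == j) U_(rshift n z)%MM (rshift n a) = (c z == j))%N.
      rewrite big_mkcond /= (bigD1 z) //= mnm1E eqxx big1 ?addn0; first by case: ifP.
      move=> a az; rewrite mnm1E (inj_eq (@rshift_inj _ _)) [z == a]eq_sym (negPf az).
      by case: ifP.
    have zero z : (\sum_(a | c a == j) U_(lshift n z)%MM (rshift n a) = 0)%N.
      by apply: big1 => a _; rewrite mnm1E eq_lrshift.
    by rewrite !one !zero cwv.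
  have deg4 : (mdeg m4 <= N)%N.
    by move: deg1; rewrite Em1 /m4 !mdegD !mdeg1.
  have m4v : (0 < m4 (rshift n v))%N.
    by rewrite /m4 !mnmDE [U_(rshift n v)%MM _]mnm1E eqxx addnA addnAC addn1.
  rewrite /same_class -[_ - _](subrKA 'X_[m4]); apply: ideal_spanD => //.
  by apply: cancel deg4 off4 off2 _ m4v m2v; rewrite E4.
move=> off off' E.
have [m0|/existsP [i mi]] := boolP [forall i, m i == 0%N].
  have m0v i : m i = 0%N by apply/eqP/(forallP m0).
  suff -> : m = m' by rewrite /same_class subrr; apply: ideal_span0.
  apply/mnmP => i; rewrite m0v; apply/esym/eqP; move/mnmP: E => E.
  case: (splitP i) => j ij; [have := E (lshift n j)|have := E (lshift n j)];
    rewrite !phi_mon_l !m0v => /esym/eqP; rewrite addn_eq0 => /andP[el er].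
    by have -> : i = lshift n j by apply: val_inj.
  by have -> : i = rshift n j by apply: val_inj.
have [v mv] : exists v, (0 < m (lshift n v) + m (rshift n v))%N.
  case: (splitP i) => j ij; exists j; rewrite addn_gt0 !lt0n.
    by have <- : i = lshift n j by [apply: val_inj]; rewrite mi.
  by have <- : i = rshift n j by [apply: val_inj]; rewrite mi orbT.
(* The degree is the sum of the vertex degrees, which the image records; it makes the swap available
   with the two monomials exchanged. *)
have degE : mdeg m' = mdeg m.
  have degP m1 : mdeg m1 = (\sum_v phi_mon c m1 (lshift n v))%N.
    by rewrite mdegE big_split_ord /= -big_split; apply: eq_bigr => z _; rewrite (phi_mon_l c).
  by rewrite !degP E.
have mv' : (0 < m' (lshift n v) + m' (rshift n v))%N by rewrite -(phi_mon_l c) -E phi_mon_l.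
move: mv mv'; rewrite !addn_gt0 => /orP[ml|mr] /orP[ml'|mr'].
- exact: cancel ml ml'.
- exact: swap ml mr'.
- rewrite /same_class -opprB; apply: ideal_spanN.
  by apply: swap ml' mr; rewrite ?degE.
- exact: cancel mr mr'.
Qed.

(** Terms involving [S] are in the ideal. Every other monomial is replaced, modulo the ideal, by a
    chosen representative with the same image. The collected coefficients are then those of
    [phi S c u], hence zero. *)
Lemma ker_phi S c u : phi S c u = 0 -> bei S (fib S c) u.
Proof.
move=> phi0; pose L := [seq m <- msupp u | supp_off S m].
pose rep M := nth 0%MM L (find (fun m => phi_mon c m == M) L).
have repP m : m \in L ->
    rep (phi_mon c m) \in L /\ phi_mon c (rep (phi_mon c m)) = phi_mon c m.
  move=> mL; have hasL : has (fun m1 => phi_mon c m1 == phi_mon c m) L.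
    by apply/hasP; exists m.
  by split; [apply: mem_nth; rewrite -has_find | apply/eqP/(nth_find 0%MM hasL)].
have LS m : m \in L -> supp_off S m by rewrite mem_filter => /andP[].
have coef0 M : \sum_(m <- L) u@_m * (phi_mon c m == M)%:R = 0.
  transitivity ((phi S c u)@_M); last by rewrite phi0 mcoeff0.
  have -> : phi S c u = \sum_(m <- msupp u) phi S c (u@_m *: 'X_[m]).
    by rewrite [in LHS](mpolyE u) rmorph_sum.
  rewrite raddf_sum /= big_filter big_mkcond /=.
  apply: eq_bigr => m _; rewrite -mul_mpolyC rmorphM /= /phi subst_C mcoeffCM.
  rewrite -/(phi S c _) phi_X.
  by case: ifP => _; rewrite ?mcoeff0 ?mulr0 ?mcoeffX.
have rep0 : \sum_(m <- L) u@_m *: 'X_[rep (phi_mon c m)] = 0 :> R.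
  pose U := undup (map (phi_mon c) L).
  transitivity (\sum_(m <- L) \sum_(M <- U)
                  (u@_m * (phi_mon c m == M)%:R) *: 'X_[rep M] : R).
    apply: eq_big_seq => m mL.
    have mU : phi_mon c m \in U by rewrite mem_undup map_f.
    rewrite (bigD1_seq _ mU (undup_uniq _)) /= eqxx mulr1 big1 ?addr0 // => M.
    by rewrite eq_sym => /negPf ->; rewrite mulr0 scale0r.
  by rewrite exchange_big /= big1 // => M _; rewrite -scaler_suml coef0 scale0r.
rewrite (mpolyE u) (bigID (supp_off S)) /=; apply: ideal_spanD; last first.
  apply: ideal_span_sum => m; rewrite negb_forall => /existsP [v].
  rewrite negb_imply negb_and -!lt0n => /andP[vS nz].
  rewrite -mul_mpolyC; apply: ideal_spanMl.
  case/orP: nz => /mnm_split_unit ->; rewrite mpolyXD; apply: ideal_spanMr;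
    [exact: bei_x | exact: bei_y].
rewrite -big_filter -/L.
suff: ideal_span (bei_gen S (fib S c)) (\sum_(m <- L) u@_m *: 'X_[m]
        - \sum_(m <- L) u@_m *: 'X_[rep (phi_mon c m)]) by rewrite rep0 subr0.
rewrite -sumrB big_seq.
apply: ideal_span_sum => m mL; rewrite -scalerBr -mul_mpolyC; apply: ideal_spanMl.
have [rL rE] := repP m mL; apply: same_classP; [exact: LS | exact: LS | by rewrite rE].
Qed.

End Components.

(** * Decomposition of binomial edge ideals into primes *)

Section Decomposition.
Variables (k : fieldType) (n : nat).
Local Notation V := 'I_n.
Local Notation R := {mpoly k[n + n]}.
Local Notation x := (@xvar k n).
Local Notation y := (@yvar k n).
Local Notation f := (@edge_binomial k n).
Local Notation bei := (@bei k n).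
Local Notation phi := (@phi k n).
Implicit Types (S : {set V}) (e : rel V) (c : V -> V).

Definition simplicial S e v : bool :=
  [forall a, forall b, restr S e v a && restr S e v b && (a != b) ==> e a b].

(** What is remembered of a prime of the decomposition, with cut set [S'] and component map [c]. The
    conditions refer to the original [S] and [e], so that they can be carried back through
    completions and deletions. *)
Record component S e S' c : Prop := Component {
  comp_sub : S \subset S';
  comp_edge : forall a b, restr S' e a b -> c a = c b;
  comp_conn : forall a b, a \notin S' -> b \notin S' -> c a = c b ->
                connect (restr S e) a b;
  comp_cut : forall v, v \in S' -> v \notin S -> ~~ simplicial S e v }.

Definition complete_nbhd S e v : rel V :=
  [rel a b | e a b || [&& restr S e v a, restr S e v b & a != b]].

Lemma complete_sym S e v : symmetric e -> symmetric (complete_nbhd S e v).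
Proof.
move=> es a b; rewrite /complete_nbhd /= es eq_sym.
by congr (_ || _); rewrite andbCA.
Qed.

Lemma not_simplicialP S e v :
  reflect (exists a b, [/\ restr S e v a, restr S e v b, a != b & ~~ e a b])
          (~~ simplicial S e v).
Proof.
rewrite negb_forall; apply: (iffP existsP) => [[a]|[a [b [va vb ab nab]]]].
  rewrite negb_forall => /existsP [b].
  by rewrite negb_imply => /andP[/andP[/andP[va vb] ab] nab]; exists a, b.
by exists a; rewrite negb_forall; apply/existsP; exists b; rewrite va vb ab nab.
Qed.

Definition kill v : R -> R :=
  subst (@mpolyC (n + n) k)
    (fun w => if w == v then 0 else x w) (fun w => if w == v then 0 else y w).

HB.instance Definition _ v := GRing.RMorphism.on (kill v).

Lemma kill_x v w : kill v (x w) = if w == v then 0 else x w.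
Proof. exact: subst_x. Qed.

Lemma kill_y v w : kill v (y w) = if w == v then 0 else y w.
Proof. exact: subst_y. Qed.

Lemma kill_f v a b :
  kill v (f a b) = if (a == v) || (b == v) then 0 else f a b.
Proof.
rewrite {1}/edge_binomial rmorphB !rmorphM /= !kill_x !kill_y.
by case: (a == v); case: (b == v); rewrite ?(mul0r, mulr0) ?subrr.
Qed.

Lemma kill_sub v p : ideal_span (fun g => g = x v \/ g = y v) (p - kill v p).
Proof.
elim/mpoly_ring_ind: p => [d|i|p q sp sq|p q sp sq].
- by rewrite /kill subst_C subrr; apply: ideal_span0.
- have base (z : bool) (w : V) : let t := if z then x w else y w in
      ideal_span (fun g => g = x v \/ g = y v) (t - kill v t).
    case: z => /=; rewrite ?kill_x ?kill_y; case: eqP => [->|_];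
      rewrite ?subrr ?subr0; try exact: ideal_span0; apply: ideal_span_gen;
      [by left | by right].
  case: (splitP i) => j ij.
    have -> : i = lshift n j by apply: val_inj.
    exact: (base true j).
  have -> : i = rshift n j by apply: val_inj.
  exact: (base false j).
- by rewrite rmorphD opprD addrACA; exact: (ideal_spanD sp sq).
- rewrite rmorphM /=.
  have -> : p * q - kill v p * kill v q
            = (p - kill v p) * q + kill v p * (q - kill v q) by ring.
  exact: (ideal_spanD (ideal_spanMr _ sp) (ideal_spanMl _ sq)).
Qed.

(* A generator f_ab of the completion, with a and b adjacent to v, is multiplied
   into the ideal of e by x_v and y_v; so the part of u involving v lies there,
   and the part free of v is governed by the deletion of v. *)
Lemma bei_cut_vertex S e v u : symmetric e -> v \notin S ->
  bei S (complete_nbhd S e v) u -> bei (v |: S) e u -> bei S e u.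
Proof.
move=> es vS uC uD; rewrite -[u](subrK (kill v u)); apply: ideal_spanD; last first.
  apply: ideal_span_morph uD => g [[s]|[a [b [ab ->]]]]; last first.
    by rewrite /= kill_f; case: ifP => _; [apply: ideal_span0 | apply: bei_f].
  rewrite in_setU1 => /orP[/eqP->|sS] [->|->];
    rewrite /= ?kill_x ?kill_y ?eqxx; try exact: ideal_span0.
    by case: ifP => _; [apply: ideal_span0 | apply: bei_x].
  by case: ifP => _; [apply: ideal_span0 | apply: bei_y].
elim: uC => [|d g w gen _ IH]; first by rewrite rmorph0 subr0; apply: ideal_span0.
rewrite rmorphD rmorphM opprD addrACA; apply: ideal_spanD => //.
have easy h : bei S e h -> kill v h = h \/ kill v h = 0 ->
    bei S e (d * h - kill v d * kill v h).
  move=> hI [->|->]; rewrite ?mulr0 ?subr0; last exact: ideal_spanMl.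
  by apply: ideal_spanB; apply: ideal_spanMl.
case: gen => [[s sS [->|->]]|[a [b [/= ab ->]]]].
- by apply: easy; [apply: bei_x | rewrite kill_x; case: ifP; [right | left]].
- by apply: easy; [apply: bei_y | rewrite kill_y; case: ifP; [right | left]].
have killf : kill v (f a b) = f a b \/ kill v (f a b) = 0.
  by rewrite kill_f; case: ifP; [right | left].
case/orP: ab => [ab|/and3P[va vb ab]]; first by apply: easy => //; apply: bei_f.
have [/and3P[eva _ _] /and3P[evb _ _]] := (va, vb).
have [av|av] := eqVneq a v; first by apply: easy => //; apply: bei_f; rewrite av.
have [bv|bv] := eqVneq b v.
  by apply: easy => //; apply: bei_f; rewrite bv es.
rewrite /= kill_f (negPf av) (negPf bv) -mulrBl.
elim: (kill_sub v d) => [|d' g' w' xy _ IH']; first by rewrite mul0r; apply: ideal_span0.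
rewrite mulrDl -mulrA; apply: ideal_spanD => //; apply: ideal_spanMl.
case: xy => ->.
  have -> : x v * f a b = x a * f v b - x b * f v a by rewrite /edge_binomial; ring.
  by apply: ideal_spanB; apply: ideal_spanMl; apply: bei_f.
have -> : y v * f a b = y a * f v b - y b * f v a by rewrite /edge_binomial; ring.
by apply: ideal_spanB; apply: ideal_spanMl; apply: bei_f.
Qed.

(** An edge added by the completion is replaced by a detour through [v], which lies outside [S]. *)
Lemma component_complete S e v S' c : symmetric e -> v \notin S ->
  component S (complete_nbhd S e v) S' c -> component S e S' c.
Proof.
move=> es vS [sub edge conn cut]; split => // [a b /= /andP[ab]|a b aS bS cab|w wS' wS].
- by move=> abS; apply: edge; rewrite /restr /complete_nbhd /= ab.
- have := conn a b aS bS cab; apply: connect_sub => a' b' /and3P[].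
  case/orP=> [ab aS' bS'|/and3P[va vb _] _ _].
    by apply: connect1; rewrite /restr /= ab aS'.
  apply: (@connect_trans _ _ v); last exact: connect1.
  by apply: connect1; rewrite restr_sym.
(* At most one of the edges from [w] to [a] and [b] is new, since otherwise [a] and [b] would both
   be neighbours of [v] and have been joined. If one is new, [v] replaces its end: [w] is adjacent
   to [v], and [v] is not adjacent to the other neighbour. *)
- have /not_simplicialP [a [b [wa wb ab]]] := cut w wS' wS.
  rewrite negb_or => /andP[nab nC]; apply/not_simplicialP.
  case/and3P: wa wb => /orP[wa|/and3P[vw va wa]] _ aS
    /and3P[/orP[wb|/and3P[vw' vb wb]] _ bS].
  + by exists a, b; rewrite /restr /= wa wb wS aS bS.
  + have wv : restr S e w v by rewrite restr_sym.
    exists a, v; rewrite wv /restr /= wa wS aS; split=> //.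
      apply: contraNneq nab => ->; by case/and3P: vb.
    apply: contraNN nC => av; rewrite vb ab andbT.
    by rewrite /restr /= es av vS aS.
  + have wv : restr S e w v by rewrite restr_sym.
    exists b, v; rewrite wv /restr /= wb wS bS; split=> //.
      by apply: contraNneq nab => ->; rewrite es; case/and3P: va.
    apply: contraNN nC => bv; rewrite va ab andbT.
    by rewrite /restr /= es bv vS bS.
  + by rewrite va vb ab in nC.
Qed.

Lemma component_delete S e v S' c : v \notin S -> ~~ simplicial S e v ->
  component (v |: S) e S' c -> component S e S' c.
Proof.
move=> vS nsv [sub edge conn cut].
have rsub a b : restr (v |: S) e a b -> restr S e a b.
  by rewrite /restr /= !in_setU1 !negb_or => /and3P[-> /andP[_ ->] /andP[_ ->]].
split => // [|a b aS bS cab|w wS' wS].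
- by apply: subset_trans sub; apply: subsetUr.
- have := conn a b aS bS cab; apply: connect_sub => a' b' /rsub.
  exact: connect1.
- have [->//|wv] := eqVneq w v.
  have /cut : w \notin v |: S by rewrite in_setU1 negb_or wv.
  move=> /(_ wS') /not_simplicialP [a [b [/rsub wa /rsub wb ab nab]]].
  by apply/not_simplicialP; exists a, b.
Qed.

(** Shortcuts at simplicial vertices shrink any path to a single edge, so the components are
    complete. *)
Lemma connect_simplicial S e a b : symmetric e ->
  (forall v, v \notin S -> simplicial S e v) ->
  connect (restr S e) a b -> a = b \/ restr S e a b.
Proof.
move=> es simp /connectP [p]; elim: p a => [|a1 p IH] a /=; first by left.
case/andP=> aa1 /IH H /H [<-|a1b]; [by right|].
have [->|ab] := eqVneq a b; [by left | right].
have [/and3P[_ aS a1S] /and3P[_ _ bS]] := (aa1, a1b).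
rewrite /restr /= aS bS !andbT; move/forallP: (simp _ a1S) => /(_ a) /forallP /(_ b).
by rewrite a1b ab (restr_sym _ es) aa1.
Qed.

(** Induction on the number of vertices outside [S] plus the number of non-edges: deletion lowers
    the first, completion the second. When all vertices outside [S] are simplicial, components are
    complete and [ker_phi] applies to the component map. *)
Theorem bei_decomposition S e u : symmetric e ->
  (forall S' c, component S e S' c -> phi S' c u = 0) -> bei S e u.
Proof.
have [N] := ubnP (#|~: S| + #|[set p | ~~ e p.1 p.2]|)%N.
elim: N S e => // N IH S e; rewrite ltnS => le es H.
have [/forallP simp|] := boolP [forall v, (v \notin S) ==> simplicial S e v].
  have simp' v vS : simplicial S e v := implyP (simp v) vS.
  have cs := sym_connect_sym (restr_sym S es).
  pose c := fingraph.root (restr S e).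
  have ker : phi S c u = 0.
    apply: H; split => // [a b ab|a b _ _ /eqP|v -> //].
      by apply/eqP; rewrite (root_connect cs); apply: connect1.
    by rewrite (root_connect cs).
  apply: ideal_span_mono (ker_phi ker) => g.
  case=> [[v vS [->|->]]|[a [b [/and3P[aS bS] /= cab ->]]]].
  - exact: bei_x.
  - exact: bei_y.
  - rewrite (root_connect cs) in cab.
    case: (connect_simplicial es simp' cab) => [->|/and3P[ab _ _]].
      by rewrite fxx; apply: ideal_span0.
    exact: bei_f.
rewrite negb_forall => /existsP [v]; rewrite negb_imply => /andP[vS nsv].
apply: (@bei_cut_vertex S e v) => //; apply: IH => //.
- apply: leq_trans le; rewrite ltn_add2l; apply: proper_card; apply/properP; split.
    by apply/subsetP => p; rewrite !inE /complete_nbhd /= negb_or => /andP[].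
  have /not_simplicialP [a [b [va vb ab nab]]] := nsv.
  by exists (a, b); rewrite !inE /complete_nbhd /= ?nab // va vb ab orbT.
- exact: complete_sym.
- by move=> S' c /(component_complete es vS); apply: H.
- apply: leq_trans le; rewrite ltn_add2r; apply: proper_card; apply/properP; split.
    by rewrite setCS subsetUr.
  by exists v; rewrite !inE ?eqxx.
- by move=> S' c /(component_delete vS nsv); apply: H.
Qed.

Lemma component_kill S e S' c u :
  component S e S' c -> bei S e u -> phi S' c u = 0.
Proof.
move=> [sub edge _ _]; apply: ideal_span_kill => g [[v vS gv]|[a [b [ab ->]]]].
  by case: gv => ->; rewrite /= ?phi_x ?phi_y (subsetP sub _ vS).
apply/eqP; rewrite phi_f_eq0; have [//|aS] := boolP (a \in S').
have [//|bS] := boolP (b \in S'); apply/eqP/edge.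
by rewrite /restr /= ab aS.
Qed.

(* Every ideal of the form [bei S e] is an intersection of primes, none of which
   may contain p without containing q. *)
Lemma bei_colon S e p q u : symmetric e ->
  (forall S' c, component S e S' c -> phi S' c p = 0 -> phi S' c q = 0) ->
  bei S e (u * (p * q)) -> bei S e (u * q).
Proof.
move=> es H uI; apply: bei_decomposition => // S' c comp.
have /eqP := component_kill comp uI; rewrite !rmorphM /= !mulf_eq0.
case/or3P=> [/eqP->|/eqP/(H _ _ comp)->|/eqP->]; by rewrite ?mul0r ?mulr0.
Qed.

End Decomposition.

(** * The d-sequence of a tree with a center and one more edge *)

Section ColonCondition.
Variable R : comNzRingType.
Implicit Types s : seq R.

Definition colon_condition s : Prop :=
  forall i j : nat, (i <= j < size s)%N -> forall u : R,
    gen_ideal (0 :: take i s) (u * (s`_i * s`_j)) ->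
    gen_ideal (0 :: take i s) (u * s`_j).

Lemma d_sequenceP s :
  minimal_generators s -> colon_condition s -> d_sequence s.
Proof.
move=> ms cs; split=> // i j ij u; split; first exact: cs.
by rewrite /colon mulrCA !gen_ideal_cons0; apply: ideal_spanMl.
Qed.

Lemma colon_condition_map (tau : {rmorphism R -> R}) s :
  involutive tau -> colon_condition s -> colon_condition (map tau s).
Proof.
move=> tauK cs i j; rewrite size_map => ij u.
have js : (j < size s)%N by case/andP: ij.
have is_ : (i < size s)%N by apply: leq_ltn_trans js; case/andP: ij.
have tr t v : gen_ideal (0 :: t) v -> gen_ideal (0 :: map tau t) (tau v).
  rewrite !gen_ideal_cons0; apply: ideal_span_morph => g gt.
  by apply: ideal_span_gen; apply: map_f.
rewrite -map_take !(nth_map 0) // => /tr.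
rewrite -map_comp map_id_in; last by move=> z _; apply: tauK.
rewrite !rmorphM !tauK => /(cs _ _ ij) /tr.
by rewrite rmorphM tauK.
Qed.

(** If [a] is missing from [t], the morphism that kills every generator but [a] kills the ideal of
    [t], so [a] is not in it. *)
Lemma minimal_generators_dual (T : comNzRingType) s : uniq s ->
  (forall a, a \in s -> exists ev : {rmorphism R -> T},
     ev a <> 0 /\ forall b, b \in s -> b != a -> ev b = 0) ->
  minimal_generators s.
Proof.
move=> us dual t ts tNs E.
have [a as_ at_] : exists2 a, a \in s & a \notin t.
  apply/allPn; apply: contraNN tNs => /allP st.
  rewrite -(size_subseq_leqif ts) eqn_leq size_subseq //=.
  exact: uniq_leq_size.
have [ev [eva evb]] := dual a as_; apply: eva.
have /E/gen_idealE : gen_ideal s a by apply/gen_idealE; apply: ideal_span_gen.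
apply: ideal_span_kill => b bt; apply: evb; first exact: mem_subseq bt.
by apply: contraNneq at_ => <-.
Qed.

End ColonCondition.

Section TreeSequence.
Variables (k : fieldType) (n : nat).
Local Notation V := 'I_n.
Local Notation R := {mpoly k[n + n]}.
Local Notation x := (@xvar k n).
Local Notation y := (@yvar k n).
Local Notation f := (@edge_binomial k n).
Local Notation g := (@parity_edge_binomial k n).
Implicit Types (l : seq (V * V)) (e h : rel V).

Definition edges_rel l : rel V := [rel a b | ((a, b) \in l) || ((b, a) \in l)].

Definition ends (p : V * V) : {set V} := [set p.1; p.2].

Lemma edges_rel_sym l : symmetric (edges_rel l).
Proof. by move=> a b; rewrite /edges_rel /= orbC. Qed.

Lemma edges_rel_ends l a b : edges_rel l a b -> [set a; b] \in map ends l.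
Proof.
by case/orP=> H; apply/mapP; [exists (a, b) | exists (b, a)]; rewrite // setUC.
Qed.

Lemma gen_ideal_edges l u :
  gen_ideal (0 :: [seq f p.1 p.2 | p <- l]) u <-> bei set0 (edges_rel l) u.
Proof.
rewrite gen_ideal_cons0; split; apply: ideal_span_mono => z.
  case/mapP=> -[a b] ab ->; apply: bei_f.
  by rewrite /edges_rel /= ab.
case=> [[v]|[a [b [/orP[ab|ab] ->]]]]; first by rewrite inE.
  by apply: ideal_span_gen; apply/mapP; exists (a, b).
by rewrite fC; apply/ideal_spanN/ideal_span_gen/mapP; exists (b, a).
Qed.

(** The last element is any [q] in the ideal of x_k0 and y_k0, so as to cover both the edge-binomial
    of the added edge and the colour swap of its parity edge-binomial. *)
Lemma tree_colon_condition (h : rel V) (k0 : V) l1 l2 (q : R) :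
  symmetric h -> acyclic h -> (forall v, v != k0 -> few_nbrs h v) ->
  (forall p, p \in l1 ++ l2 -> h p.1 p.2) ->
  uniq (map ends (l1 ++ l2)) ->
  (forall p, p \in l1 -> k0 \notin ends p) ->
  (forall p, p \in l2 -> k0 \in ends p) ->
  ideal_span (fun z => z = x k0 \/ z = y k0) q ->
  colon_condition (rcons [seq f p.1 p.2 | p <- l1 ++ l2] q).
Proof.
move=> hs ha hdeg hl ul l1k l2k qk i j; rewrite size_rcons size_map ltnS => /andP[ij jl] u.
set l := l1 ++ l2 in hl ul jl *.
have il : (i <= size l)%N := leq_trans ij jl.
have -> : take i (rcons [seq f p.1 p.2 | p <- l] q) = [seq f p.1 p.2 | p <- take i l].
  by rewrite -cats1 takel_cat ?size_map // map_take.
rewrite !gen_ideal_edges; apply: bei_colon; first exact: edges_rel_sym.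
move=> S' c comp; rewrite !nth_rcons size_map.
move: il; rewrite leq_eqVlt => /orP[/eqP il|il].
  by have -> : j = i; [apply/eqP; rewrite eqn_leq ij il jl | rewrite il ltnn eqxx].
rewrite il; set qj := if (j < _)%N then _ else _.
rewrite (nth_map (k0, k0)) // /qj {qj}; set p := nth _ l i.
have pl : p \in l by apply: mem_nth.
have before a b : edges_rel (take i l) a b -> h a b && ([set a; b] != ends p).
  move=> ab; apply/andP; split.
    by case/orP: ab => /mem_take /hl //=; rewrite hs.
  apply: contraTneq ul => Eab; rewrite -(cat_take_drop i l) map_cat cat_uniq.
  rewrite [X in _ && (X && _)](_ : _ = false) ?andbF //; apply/negbTE; rewrite negbK.
  apply/hasP; exists (ends p); last by rewrite -Eab edges_rel_ends.
  by apply/map_f; rewrite (drop_nth (k0, k0)) // mem_head.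
(* Edges after one in [l2] are again in [l2], so once [k0] is cut all later elements vanish, [q]
   included. *)
have center : k0 \in S' -> k0 \in ends p ->
    phi S' c (if (j < size l)%N then nth 0 [seq f p.1 p.2 | p <- l] j
              else if j == size l then q else 0) = 0.
  move=> kS kp; case: ifP => [jl'|_]; last first.
    case: ifP => _; last by rewrite rmorph0.
    by apply: ideal_span_kill qk => z [->|->]; rewrite /= ?phi_x ?phi_y kS.
  rewrite (nth_map (k0, k0)) //; set p' := nth _ l j.
  apply/eqP; rewrite phi_f_eq0.
  have : k0 \in ends p'.
    have li : (size l1 <= i)%N.
      rewrite leqNgt; apply: contraL kp => il1; apply: l1k.
      by rewrite /p /l nth_cat il1 mem_nth.
    apply: l2k; rewrite /p' /l nth_cat ltnNge (leq_trans li ij) /= mem_nth //.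
    by rewrite ltn_subLR ?(leq_trans li ij) // -size_cat.
  by rewrite /ends !inE => /orP[] /eqP <-; rewrite kS ?orbT.
(* A cut vertex has two neighbours along earlier edges. With the other end of [p] these are three
   neighbours in [h], which only [k0] can have. *)
have cutE v w : h v w -> ends p = [set v; w] -> v \in S' ->
    k0 \in S' /\ k0 \in ends p.
  move=> vw pE vS; have := comp_cut comp vS; rewrite inE => /(_ isT).
  case/not_simplicialP=> a [b [/and3P[/before /andP[va na] _ _]]].
  case/and3P=> /before /andP[vb nb] _ _ ab _.
  have vk : v = k0.
    apply/eqP; apply: contraNT ab => /hdeg /(_ a b w va vb vw).
    by case/or3P => // /eqP E; [case/eqP: na|case/eqP: nb]; rewrite E pE.
  by rewrite -vk vS pE !inE eqxx.
move/eqP; rewrite phi_f_eq0.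
have [p1S _|p1S] := boolP (p.1 \in S').
  by have [] := cutE _ _ (hl _ pl) erefl p1S; apply: center.
have [p2S _|p2S /eqP cp] := boolP (p.2 \in S').
  have hp : h p.2 p.1 by rewrite hs hl.
  by have [] := cutE _ _ hp (setUC _ _) p2S; apply: center.
(* With neither end cut, the ends would be connected by earlier edges, against acyclicity. *)
have := comp_conn comp p1S p2S cp => conn; case/negP: (ha _ _ (hl _ pl)).
apply: connect_sub conn => a b /and3P[/before ab _ _]; exact: connect1.
Qed.

Definition upper_pairs (e : rel V) : seq (V * V) :=
  [seq p : V * V <- enum {: V * V} | (p.1 < p.2)%N && e p.1 p.2].

Lemma binomials_ofE b (e : rel V) :
  @binomials_of k n b e = [seq b p.1 p.2 | p <- upper_pairs e].
Proof. by []. Qed.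

Lemma upper_pairsE (e : rel V) (p : V * V) :
  (p \in upper_pairs e) = (p.1 < p.2)%N && e p.1 p.2.
Proof. by rewrite mem_filter mem_enum andbT. Qed.

Lemma upper_pairs_uniq (e : rel V) : uniq (upper_pairs e).
Proof. exact/filter_uniq/enum_uniq. Qed.

Lemma ends_inj (p q : V * V) : (p.1 < p.2)%N -> (q.1 < q.2)%N ->
  ends p = ends q -> p = q.
Proof.
case: p q => a b [c d] /= ab cd /setP E.
have := E a; have := E b; rewrite !inE !eqxx orbT /= => /esym/orP eb /esym/orP ea.
case: ea eb ab => /eqP -> [] /eqP ->; rewrite ?ltnn // => dc.
by have := ltn_trans dc cd; rewrite ltnn.
Qed.

Lemma upper_minimal (b : V -> V -> R) L :
  (forall p : V * V, (p.1 < p.2)%N -> exists ev : {rmorphism R -> k},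
     ev (b p.1 p.2) <> 0 /\
     forall q : V * V, (q.1 < q.2)%N -> q != p -> ev (b q.1 q.2) = 0) ->
  uniq L -> all (fun p : V * V => p.1 < p.2)%N L ->
  minimal_generators [seq b p.1 p.2 | p <- L].
Proof.
move=> dual uL /allP upL; apply: (@minimal_generators_dual _ k).
  rewrite map_inj_in_uniq // => p q pL qL E; apply/eqP; apply: contraT => pq.
  have [ev [evp evq]] := dual _ (upL _ pL); case: evp; rewrite E.
  by apply: evq; [exact: upL | rewrite eq_sym].
move=> _ /mapP[p pL ->]; have [ev [evp evq]] := dual _ (upL _ pL).
exists ev; split=> // _ /mapP[q qL ->] ne; apply: evq; first exact: upL.
by apply: contraNneq ne => ->.
Qed.

Lemma edge_dual (p : V * V) : (p.1 < p.2)%N -> exists ev : {rmorphism R -> k},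
     ev (f p.1 p.2) <> 0 /\
     forall q : V * V, (q.1 < q.2)%N -> q != p -> ev (f q.1 q.2) = 0.
Proof.
case: p => i j /= ij.
(* The rows x and y become the i-th and j-th unit vectors, whose only nonzero minor sits in the
   columns i and j. *)
exists (subst idfun (fun v => (v == i)%:R) (fun v => (v == j)%:R)); split.
  rewrite /= subst_f !eqxx (negPf _ : (j == i) = false) ?mul0r ?subr0 ?mulr1.
    by apply/eqP; apply: oner_neq0.
  by apply: contraTneq ij => ->; rewrite ltnn.
case=> a b /= ab ne; rewrite subst_f -!natrM !mulnb.
case: (_ && _) / andP => [[/eqP ai /eqP bj]|_]; first by rewrite ai bj eqxx in ne.
case: (_ && _) / andP => [[/eqP bi /eqP aj]|_]; last by rewrite subrr.
by rewrite bi aj in ab; have := ltn_trans ab ij; rewrite ltnn.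
Qed.

Lemma parity_dual (p : V * V) : (p.1 < p.2)%N -> exists ev : {rmorphism R -> k},
     ev (g p.1 p.2) <> 0 /\
     forall q : V * V, (q.1 < q.2)%N -> q != p -> ev (g q.1 q.2) = 0.
Proof.
move=> pp.
(* With y zero and x the indicator of the ends of [p], a product x_a x_b with a < b survives only
   for [p] itself. *)
exists (subst idfun (fun v => (v \in ends p)%:R) (fun v => 0)); split.
  by rewrite /= subst_g !inE !eqxx orbT mul0r subr0 mulr1; apply/eqP/oner_neq0.
move=> q qq ne; rewrite /= subst_g -natrM mulnb mul0r subr0.
case: (_ && _) / andP => // -[q1 q2]; case/eqP: ne; apply: ends_inj => //.
apply/eqP; rewrite eqEcard subUset !sub1set q1 q2 /= /ends !cards2.
by move: qq pp; rewrite !ltn_neqAle -!val_eqE /= => /andP[-> _] /andP[-> _].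
Qed.

Definition upper (a b : V) : V * V := if (a < b)%N then (a, b) else (b, a).

Lemma ends_upper a b : ends (upper a b) = [set a; b].
Proof. by rewrite /upper; case: ifP => _ //; rewrite /ends setUC. Qed.

Lemma edge_list e h k0 z : center_plus_edge e h k0 z ->
  exists l1 l2, [/\ perm_eq (rcons (l1 ++ l2) (upper k0 z)) (upper_pairs e),
    forall p, p \in l1 ++ l2 -> h p.1 p.2,
    uniq (map ends (l1 ++ l2)),
    forall p, p \in l1 -> k0 \notin ends p &
    forall p, p \in l2 -> k0 \in ends p].
Proof.
move=> [hs _ _ k0z nh eE].
pose l1 := [seq p <- upper_pairs h | k0 \notin ends p].
pose l2 := [seq p <- upper_pairs h | k0 \in ends p].
have memE p : (p \in l1 ++ l2) = (p \in upper_pairs h).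
  by rewrite mem_cat !mem_filter -andb_orl orNb.
have uu : uniq (l1 ++ l2).
  rewrite cat_uniq; apply/and3P; split; try exact/filter_uniq/upper_pairs_uniq.
  by apply/hasPn => p; rewrite !mem_filter => /andP[-> _].
have upl : ((upper k0 z).1 < (upper k0 z).2)%N.
  rewrite /upper; case: (ltngtP k0 z) => //= E.
  by rewrite (ord_inj E) eqxx in k0z.
exists l1, l2; split.
- apply: uniq_perm; [rewrite rcons_uniq uu andbT | exact: upper_pairs_uniq |].
    rewrite memE upper_pairsE upl /=.
    by rewrite /upper; case: ifP => _ //=; rewrite hs.
  move=> p; rewrite mem_rcons inE memE !upper_pairsE eE /add_edge /=.
  have [p12|] := boolP (p.1 < p.2)%N; last first.
    rewrite orbF; apply: contraNF => /eqP -> //.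
  rewrite /= orbC; congr (_ || _); apply/eqP/idP => [->|].
    by rewrite /upper; case: ifP => _ /=; rewrite !eqxx ?orbT.
  case: p p12 => a b /= ab; rewrite /upper => /orP[] /andP[/eqP E1 /eqP E2].
    by rewrite -E1 -E2 ab.
  by rewrite -E1 -E2 ltnNge ltnW.
- by move=> p; rewrite memE upper_pairsE => /andP[].
- rewrite map_inj_in_uniq // => p q; rewrite !memE !upper_pairsE.
  by move=> /andP[pp _] /andP[qq _]; apply: ends_inj.
- by move=> p; rewrite mem_filter => /andP[].
- by move=> p; rewrite mem_filter => /andP[].
Qed.

Lemma form_d_sequence_upper b e L :
  (forall p : V * V, (p.1 < p.2)%N -> exists ev : {rmorphism R -> k},
     ev (b p.1 p.2) <> 0 /\
     forall q : V * V, (q.1 < q.2)%N -> q != p -> ev (b q.1 q.2) = 0) ->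
  perm_eq L (upper_pairs e) ->
  colon_condition [seq b p.1 p.2 | p <- L] ->
  @form_d_sequence k n b e.
Proof.
move=> dual Le colL; exists [seq b p.1 p.2 | p <- L].
  by rewrite binomials_ofE; apply: perm_map.
apply: d_sequenceP => //; apply: upper_minimal => //.
  by rewrite (perm_uniq Le) upper_pairs_uniq.
by apply/allP => p; rewrite (perm_mem Le) upper_pairsE => /andP[].
Qed.

Lemma center_plus_edge_d_sequence e h k0 z :
  center_plus_edge e h k0 z -> edge_binomials_form_d_sequence k e.
Proof.
move=> cpe; have [l1 [l2 [pe hl ul l1k l2k]]] := edge_list cpe.
apply: form_d_sequence_upper pe _; first exact: edge_dual.
rewrite map_rcons; have [hs ha hd _ _ _] := cpe.
apply: (tree_colon_condition hs ha hd) => //.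
rewrite /upper /edge_binomial; case: ifP => _ /=; apply: ideal_spanB;
  by [apply/ideal_spanMl/ideal_span_gen; auto
    | apply/ideal_spanMr/ideal_span_gen; auto].
Qed.

Definition swap_xy (col : V -> bool) : R -> R :=
  subst (@mpolyC (n + n) k) (fun v => if col v then y v else x v)
                            (fun v => if col v then x v else y v).

HB.instance Definition _ col := GRing.RMorphism.on (swap_xy col).

Lemma swap_x col v : swap_xy col (x v) = if col v then y v else x v.
Proof. exact: subst_x. Qed.

Lemma swap_y col v : swap_xy col (y v) = if col v then x v else y v.
Proof. exact: subst_y. Qed.

Lemma swap_xyK col : involutive (swap_xy col).
Proof.
elim/mpoly_ring_ind => [d|i|p q Ep Eq|p q Ep Eq].
- by rewrite /swap_xy !subst_C.
- case: (splitP i) => j ij.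
    have -> : i = lshift n j by apply: val_inj.
    rewrite -/(x j) swap_x; case E: (col j); by rewrite ?swap_x ?swap_y E.
  have -> : i = rshift n j by apply: val_inj.
  rewrite -/(y j) swap_y; case E: (col j); by rewrite ?swap_x ?swap_y E.
- by rewrite !rmorphD /= Ep Eq.
- by rewrite !rmorphM /= Ep Eq.
Qed.

Lemma center_plus_edge_parity e h k0 z (col : V -> bool) :
  center_plus_edge e h k0 z -> (forall u v, h u v -> col u != col v) ->
  parity_edge_binomials_form_d_sequence k e.
Proof.
move=> cpe colP; have [l1 [l2 [pe hl ul l1k l2k]]] := edge_list cpe.
apply: form_d_sequence_upper pe _; first exact: parity_dual.
have [hs ha hd _ _ _] := cpe.
(* Each edge is oriented away from its end of colour [false]; then the swap turns [f] into [g] with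
   the right sign. *)
pose o (p : V * V) := if col p.1 then (p.2, p.1) else p.
have endso p : ends (o p) = ends p.
  by rewrite /o; case: ifP => _ //; rewrite /ends setUC.
set q := g (upper k0 z).1 (upper k0 z).2.
have -> : [seq g p.1 p.2 | p <- rcons (l1 ++ l2) (upper k0 z)]
          = map (swap_xy col)
              (rcons [seq f p.1 p.2 | p <- map o l1 ++ map o l2] (swap_xy col q)).
  rewrite !map_rcons swap_xyK -map_cat -!map_comp; congr rcons.
  apply/eq_in_map => p /hl /colP; rewrite /o /=.
  rewrite /edge_binomial /parity_edge_binomial rmorphB !rmorphM.
  by case E1: (col p.1); case E2: (col p.2) => //= _;
    rewrite !swap_x !swap_y E1 E2; ring.
apply: colon_condition_map; first exact: swap_xyK.
apply: (tree_colon_condition hs ha hd); rewrite -?map_cat.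
- move=> _ /mapP[p /hl hp ->]; rewrite /o; case: ifP => _ //=.
  by rewrite hs.
- by rewrite -map_comp (eq_map endso).
- by move=> _ /mapP[p /l1k hp ->]; rewrite endso.
- by move=> _ /mapP[p /l2k hp ->]; rewrite endso.
(* The ends of the added edge may have the same colour, so the swap of [q] need not be an
   edge-binomial; its membership in the ideal of x_k0 and y_k0 is enough. *)
have gk : ideal_span (fun t => t = x k0 \/ t = y k0) q.
  rewrite /q /upper /parity_edge_binomial; case: ifP => _ /=; apply: ideal_spanB;
  by [apply/ideal_spanMl/ideal_span_gen; auto
    | apply/ideal_spanMr/ideal_span_gen; auto].
apply: ideal_span_morph gk => _ [->|->] /=; rewrite ?swap_x ?swap_y;
  by case: ifP => _; apply: ideal_span_gen; auto.
Qed.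

End TreeSequence.

(** * Edge orders that form a d-sequence *)

Section Necessity.
Variables (k : fieldType) (n : nat).
Local Notation V := 'I_n.
Local Notation R := {mpoly k[n + n]}.
Local Notation x := (@xvar k n).
Local Notation y := (@yvar k n).
Local Notation f := (@edge_binomial k n).
Variable L : seq (V * V).
Hypothesis dL : d_sequence [seq f p.1 p.2 | p <- L].

Definition prefix_rel i : rel V := edges_rel (take i L).

(** A rational point: (0, 0) at the vertices of [S], and (1, 0) or (1, 1) elsewhere according to the
    colour, so that outside [S] an edge-binomial vanishes exactly when the colours agree. *)
Definition point (S : {set V}) (col : V -> bool) : R -> k :=
  subst idfun (fun v => (v \notin S)%:R) (fun v => ((v \notin S) && col v)%:R).

HB.instance Definition _ S col := GRing.RMorphism.on (point S col).

Lemma point_f (S : {set V}) col a b : a \notin S -> b \notin S ->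
  (point S col (f a b) == 0) = (col a == col b).
Proof.
move=> aS bS; rewrite /point subst_f aS bS !mul1r /= subr_eq0.
by case: (col a); case: (col b); rewrite ?eqxx // ?oner_eq0 // eq_sym oner_eq0.
Qed.

(* Multiplying by the x_w with w outside S leaves only the minimal primes whose
   cut set lies in S. *)
Lemma d_sequence_point i j (S : {set V}) q (col : V -> bool) (p0 : V * V) :
  (i <= j < size L)%N ->
  (forall S' c, component set0 (prefix_rel i) S' c -> S' \subset S ->
     phi S' c (q * f (nth p0 L i).1 (nth p0 L i).2) = 0) ->
  (forall a b, restr S (prefix_rel i) a b -> col a = col b) ->
  point S col q != 0 ->
  point S col (f (nth p0 L j).1 (nth p0 L j).2) = 0.
Proof.
move=> ij qf colE qn; pose X := \prod_(w | w \notin S) x w.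
have jL : (j < size L)%N by case/andP: ij.
have iL : (i < size L)%N by apply: leq_ltn_trans jL; case/andP: ij.
set fi := f (nth p0 L i).1 _ in qf; set fj := f _ _.
have memI : bei set0 (prefix_rel i) (q * X * fi).
  apply: bei_decomposition; first exact: edges_rel_sym.
  move=> S' c comp; have [sub|/subsetPn [w wS' wS]] := boolP (S' \subset S).
    by rewrite mulrAC rmorphM /= qf // mul0r.
  rewrite !rmorphM rmorph_prod (bigD1 w) //= phi_x wS'.
  by rewrite mul0r mulr0 mul0r.
have ij' : (i <= j < size [seq f p.1 p.2 | p <- L])%N by rewrite size_map.
have [_ /(_ i j ij' (q * X)) [+ _]] := dL.
rewrite /colon -map_take !gen_ideal_edges !(nth_map p0) // -/fi -/fj -/(prefix_rel i).
move=> H; have /H memJ : bei set0 (prefix_rel i) (q * X * (fi * fj)).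
  by rewrite mulrA mulrC; apply: ideal_spanMl.
have : point S col (q * X * fj) = 0.
  apply: ideal_span_kill memJ => t [[v]|[a [b [ab ->]]]]; first by rewrite inE.
  have [aS|aS] := boolP (a \in S).
    by rewrite /= /point subst_f aS !mul0r mulr0 subrr.
  have [bS|bS] := boolP (b \in S).
    by rewrite /= /point subst_f bS mulr0 !mul0r subrr.
  by apply/eqP; rewrite point_f // (colE a b) // /restr /= ab aS.
rewrite !rmorphM rmorph_prod /= => /eqP; rewrite !mulf_eq0 (negPf qn) /=.
rewrite big1 ?oner_eq0 => [/eqP //|w wS].
by rewrite /point subst_x wS.
Qed.

(** Empty [S] and [q = 1]: the prime with empty cut set contains the i-th binomial, so the j-th one
    vanishes at the point coloured by the component of its first end. *)
Lemma d_sequence_cycle i j (p0 : V * V) : (i <= j < size L)%N ->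
  connect (prefix_rel i) (nth p0 L i).1 (nth p0 L i).2 ->
  connect (prefix_rel i) (nth p0 L j).1 (nth p0 L j).2.
Proof.
move=> ij coni; have cs := sym_connect_sym (@edges_rel_sym _ (take i L)).
apply: contraT => nconj.
have := @d_sequence_point i j set0 1
  (fun v => connect (prefix_rel i) (nth p0 L j).1 v) p0 ij.
have side1 S' c : component set0 (prefix_rel i) S' c -> S' \subset set0 ->
    phi S' c (1 * f (nth p0 L i).1 (nth p0 L i).2) = 0.
  move=> comp; rewrite subset0 => /eqP S0; rewrite mul1r; apply/eqP.
  rewrite phi_f_eq0; apply/or3P/Or33/eqP; apply: connect_const coni => w w' ww'.
  by apply: (comp_edge comp); rewrite /restr /= ww' S0 !inE.
have side2 w w' : restr set0 (prefix_rel i) w w' ->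
    connect (prefix_rel i) (nth p0 L j).1 w = connect (prefix_rel i) (nth p0 L j).1 w'.
  by case/and3P=> ww' _ _; apply: same_connect_r => //; apply: connect1.
move/(_ side1 side2); rewrite rmorph1 oner_neq0 => /(_ isT) /eqP.
by rewrite point_f ?inE // connect0 eq_sym (negPf nconj).
Qed.

(** The multiplier is [f a b]. In a prime with cut set inside [S], either [v] is cut and the i-th
    binomial vanishes, or [a] and [b] share the class of [v] and [f a b] vanishes. So the j-th
    binomial vanishes at each point whose colouring is constant on components and separates [a] from
    [b]. *)
Lemma d_sequence_branch i j (S : {set V}) (p0 : V * V) v a b : (i <= j < size L)%N ->
  v \in ends (nth p0 L i) -> prefix_rel i v a -> prefix_rel i v b ->
  v \in S -> a \notin S -> b \notin S ->
  ~~ connect (restr S (prefix_rel i)) a b ->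
  (nth p0 L j).1 \notin S -> (nth p0 L j).2 \notin S ->
  connect (restr S (prefix_rel i)) (nth p0 L j).1 (nth p0 L j).2.
Proof.
move=> ij vi va vb vS aS bS nab; set a' := _.1; set b' := _.2 => aS' bS'.
have cs := sym_connect_sym (restr_sym S (@edges_rel_sym _ (take i L))).
apply: contraT => nab'; exfalso.
have step (col : V -> bool) : (forall w w', restr S (prefix_rel i) w w' -> col w = col w') ->
    col a != col b -> col a' != col b' -> False.
  move=> colE cab; case/negP; rewrite -(point_f col aS' bS').
  apply/eqP; apply: (@d_sequence_point i j S (f a b)) => //; last by rewrite point_f.
  move=> S' c [_ edge _ _] /subsetP sub; rewrite rmorphM; apply/eqP.
  rewrite mulf_eq0 !phi_f_eq0.
  have nS w : w \notin S -> w \notin S' by apply: contra => /sub.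
  have [vS'|vS'] := boolP (v \in S').
    by move: vi; rewrite !inE => /orP[] /eqP <-; rewrite vS' ?orbT.
  by rewrite -(edge v a) -?(edge v b) ?eqxx ?orbT // /restr /= ?va ?vb vS' nS.
have conn w0 w w' : restr S (prefix_rel i) w w' ->
    connect (restr S (prefix_rel i)) w0 w = connect (restr S (prefix_rel i)) w0 w'.
  by move=> ww'; apply: same_connect_r => //; apply: connect1.
set C := connect _ in nab nab' conn *.
have C0 w : C w w by exact: connect0.
have CC w w' : C w w' = C w' w by exact: cs.
(* A colouring separating both pairs: the component of [a], or that of [b], if it separates [a']
   from [b']. Otherwise neither [a] nor [b] lies in the component of [a'] or [b'], and the
   components of [a] and [a'] together serve. *)
have [aa'|aa'] := boolP (C a a' == C a b'); last first.
  by apply: (step (C a)) => //; [exact: conn | rewrite C0 eq_sym (negPf nab)].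
have [ba'|ba'] := boolP (C b a' == C b b'); last first.
  by apply: (step (C b)) => //; [exact: conn | rewrite C0 CC (negPf nab)].
have nC w : C w a' == C w b' -> ~~ C w a'.
  move=> /eqP E; apply: contraNN nab' => wa'.
  by apply: (connect_trans (y := w)); [rewrite -/C CC | rewrite -/C -E].
apply: (step (fun w => C a w || C a' w)) => [w w' ww'||].
- by rewrite !(conn _ _ _ ww').
- by rewrite C0 (negPf nab) /= CC eq_sym (negPf (nC _ ba')).
- by rewrite C0 orbT -(eqP aa') (negPf (nC _ aa')) (negPf nab').
Qed.

End Necessity.

(** * Prefixes of an order on the edges *)

Section EdgeOrder.
Variables (n : nat).
Local Notation V := 'I_n.
Variables (e : rel V) (L : seq (V * V)) (p0 : V * V).
Hypotheses (e_sym : symmetric e) (e_irr : irreflexive e).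
Hypothesis L_perm : perm_eq L (upper_pairs e).
Local Notation pre := (prefix_rel L).
Local Notation "L_[ i ]" := (nth p0 L i) (at level 0, format "L_[ i ]").

Lemma edges_relE l a b : edges_rel l a b = ([set a; b] \in map (@ends n) l).
Proof.
apply/idP/idP; first exact: edges_rel_ends.
case/mapP=> -[c d] cd; rewrite /ends /= => /set2_eq; rewrite /edges_rel /=.
by case=> [[-> ->]|[-> ->]]; rewrite cd ?orbT.
Qed.

Lemma prefix_relE i a b : pre i a b = ([set a; b] \in take i (map (@ends n) L)).
Proof. by rewrite /prefix_rel edges_relE map_take. Qed.

Lemma ends_uniq : uniq (map (@ends n) L).
Proof.
have [uL mL] := (perm_uniq L_perm, perm_mem L_perm).
rewrite map_inj_in_uniq ?uL ?upper_pairs_uniq // => p q.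
rewrite !mL !upper_pairsE => /andP[pp _] /andP[qq _]; exact: ends_inj.
Qed.

Lemma edge_mem a b : e a b = ([set a; b] \in map (@ends n) L).
Proof.
apply/idP/mapP => [ab|[p]].
  have nab : a != b by apply: contraTneq ab => ->; rewrite e_irr.
  exists (upper a b); last by rewrite ends_upper.
  rewrite (perm_mem L_perm) upper_pairsE /upper.
  case: (ltngtP a b) => [ab'|ba'|/ord_inj E] /=; first by rewrite ab' ab.
    by rewrite ba' e_sym ab.
  by rewrite E eqxx in nab.
rewrite (perm_mem L_perm) upper_pairsE => /andP[_ pe] /set2_eq.
by case=> [[-> ->]|[-> ->]] //; rewrite e_sym.
Qed.

Lemma pre_sub i : subrel (pre i) e.
Proof. by move=> a b; rewrite prefix_relE => /mem_take; rewrite edge_mem. Qed.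

Lemma pre_sym i : symmetric (pre i).
Proof. exact: edges_rel_sym. Qed.

Lemma pre_index i a b : e a b ->
  pre i a b = (index [set a; b] (map (@ends n) L) < i)%N.
Proof.
rewrite edge_mem prefix_relE => H.
have [le|lt] := leqP (size (map (@ends n) L)) i.
  by rewrite take_oversize // H; apply/esym; apply: leq_trans le; rewrite index_mem.
by rewrite in_take // ltnW.
Qed.

Lemma index_ends i : (i < size L)%N -> index (ends L_[i]) (map (@ends n) L) = i.
Proof.
move=> iL; rewrite -(nth_map p0 (ends p0)) // index_uniq ?size_map //.
exact: ends_uniq.
Qed.

Lemma edge_L i : (i < size L)%N -> e L_[i].1 L_[i].2.
Proof. by move=> iL; rewrite edge_mem -/(ends L_[i]) map_f // mem_nth. Qed.

Lemma L_notin_pre i j : (i <= j < size L)%N -> ~~ pre i L_[j].1 L_[j].2.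
Proof.
case/andP=> ij jL; rewrite pre_index ?edge_L // -/(ends L_[j]) index_ends //.
by rewrite -leqNgt.
Qed.

Lemma pre_mono i j : (i <= j)%N -> subrel (pre i) (pre j).
Proof.
move=> ij a b ab; have eab := pre_sub ab; move: ab.
by rewrite !pre_index // => /leq_trans; apply.
Qed.

(** The edge of the cycle that comes last in [L]: the rest of the cycle joins its ends by earlier
    edges. *)
Lemma cycle_closing c : ucycle e c -> (3 <= size c)%N ->
  exists2 i, (i < size L)%N & connect (pre i) L_[i].1 L_[i].2.
Proof.
case/andP=> cyc uc sc; pose idx a := index [set a; next c a] (map (@ends n) L).
have [x0 x0c] : exists x0, x0 \in c by case: (c) sc => // x0 c' _; exists x0; rewrite mem_head.
pose x := [arg max_(a > x0 in c) idx a].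
have [xc xmax] : x \in c /\ forall a, a \in c -> (idx a <= idx x)%N.
  by rewrite /x; case: arg_maxnP.
have enext a : a \in c -> e a (next c a) by move=> ac; apply: next_cycle.
have idxL a : a \in c -> (idx a < size L)%N.
  by move=> ac; rewrite -(size_map (@ends n)) index_mem -edge_mem enext.
exists (idx x); first exact: idxL.
have [r c' Ec] := rot_to xc.
have nextE a : next c a = next (x :: c') a by rewrite -Ec next_rot.
have uc' : uniq (x :: c') by rewrite -Ec rot_uniq.
have sc' : (3 <= size (x :: c'))%N by rewrite -Ec size_rot.
case: c' Ec nextE uc' sc' => [|y [|w s]] // Ec nextE uc' _.
have nx : next c x = y by rewrite nextE /= eqxx.
have ny : next c y = w.
  rewrite nextE /=; move: uc' => /= /andP[]; rewrite inE negb_or => /andP[xy _] _.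
  by rewrite [y == x]eq_sym (negPf xy) eqxx.
have con : connect (pre (idx x)) y x.
  apply/connectP; exists (rcons (w :: s) x); last by rewrite last_rcons.
  apply/(pathP x) => t; rewrite size_rcons => ts.
  have cy : path (frel (next (x :: y :: w :: s))) x (rcons [:: y, w & s] x).
    exact: cycle_next uc'.
  have pth : path (frel (next (x :: y :: w :: s))) y (rcons (w :: s) x).
    by case/andP: cy.
  have := elimT (pathP x) pth t; rewrite size_rcons => /(_ ts);
  set a := nth x _ t; set b := nth x _ t => /eqP ab.
  have aE : a = nth x [:: y, w & s] t by rewrite /a -rcons_cons nth_rcons ts.
  have ac' : a \in [:: y, w & s] by rewrite aE mem_nth.
  have ac : a \in c by rewrite -(mem_rot r) Ec inE ac' orbT.
  have ax : a != x.
    by move: uc'; rewrite cons_uniq => /andP[nx' _]; apply: contraNneq nx' => <-.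
  have {}ab : next c a = b by rewrite nextE.
  rewrite -ab pre_index ?enext // ltn_neqAle -/(idx a) xmax // andbT.
  (* Equal positions mean equal edges. Then [a] is [x], or [a] is [y] and its successor [w] is [x],
     impossible on a cycle of length at least 3. *)
  apply: contraNneq ax => /(congr1 (nth (ends p0) (map (@ends n) L))).
  rewrite !nth_index -?edge_mem ?enext // nx => /set2_eq [[-> //]|[ay]].
  by rewrite ay ny => wx; move: uc'; rewrite wx /= !inE eqxx orbT.
have Ex : ends L_[idx x] = [set x; y].
  rewrite -(nth_map p0 (ends p0)) ?idxL // nth_index ?nx //.
  by rewrite -nx -edge_mem enext.
move: Ex => /set2_eq [[-> ->]|[-> ->]] //.
by rewrite (sym_connect_sym (@pre_sym _)).
Qed.

End EdgeOrder.

(** * Two adjacent branching vertices are impossible *)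

Section TwoBranches.
Variables (V : finType) (h K : rel V).
Hypotheses (h_sym : symmetric h) (h_irr : irreflexive h) (h_acyclic : acyclic h).
Hypotheses (K_sym : symmetric K) (Kh : subrel K h).

(** The conclusion of [d_sequence_branch] for the closing edge [p q], with [K] the edges before the
    one at [v]. *)
Definition forces (v a b p q : V) : Prop := forall S : {set V},
  v \in S -> a \notin S -> b \notin S -> p \notin S -> q \notin S ->
  connect (restr S K) p q.

Lemma forcesC v a b p q : forces v a b p q -> forces v a b q p.
Proof.
move=> F S vS aS bS pS qS.
by rewrite (sym_connect_sym (restr_sym S K_sym)); apply: F.
Qed.

(** Forcing is applied to the set of [v] and [c]. *)
Lemma separated_not_forced v a b p q c : forces v a b p q ->
  v != p -> v != q -> c != p -> c != q ->
  c != a -> c != b -> v != a -> v != b ->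
  ~~ connect (restr [set c] h) p q -> False.
Proof.
move=> F vp vq cp cq ca cb va vb /negP; apply.
have := F [set v; c]; rewrite !inE eqxx (eq_sym a) (eq_sym a) (eq_sym b) (eq_sym b).
rewrite (eq_sym p) (eq_sym p) (eq_sym q) (eq_sym q).
rewrite (negPf vp) (negPf vq) (negPf cp) (negPf cq) (negPf ca) (negPf cb).
rewrite (negPf va) (negPf vb) => /(_ isT isT isT isT isT).
apply: connect_mono => w w' /and3P[/Kh ww' wS w'S]; rewrite /restr /= ww' !inE.
by move: wS w'S; rewrite !inE !negb_or => /andP[_ ->] /andP[_ ->].
Qed.

Variables (v v' a b a' b' p q : V).
Hypotheses (vv' : h v v') (nK : ~~ connect K v v').
Hypotheses (va : K v a) (vb : K v b) (va' : K v' a') (vb' : K v' b').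
Hypotheses (pq : p != q) (npq : ~~ h p q).
Hypotheses (F : forces v a b p q) (F' : forces v' a' b' p q).

Let K_neq w w' : K w w' -> w != w'.
Proof. by move=> /Kh; apply: contraTneq => ->; rewrite h_irr. Qed.

Let not_nbr w c d : ~~ connect K w c -> K w d -> c != d.
Proof. by move=> nc wd; apply: contraNneq nc => ->; apply: connect1. Qed.

(** If [p = v], forcing at [v'] gives a path from [p] to [q] avoiding [v']. Its first interior
    vertex [c] is in the [K]-component of [v], so it is neither [a'] nor [b'], and [v'] with [c]
    contradicts forcing. *)
Lemma branch_not_end : p != v.
Proof.
apply/negP => /eqP pv.
have vNv' : v != v' by apply: contraNneq nK => ->.
have qv' : q != v' by apply: contraNneq npq => ->; rewrite pv.
have nK' : ~~ connect K v' v by rewrite (sym_connect_sym K_sym).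
have av' : v != a' := not_nbr nK' va'.
have bv' : v != b' := not_nbr nK' vb'.
have con : connect (restr [set v'] K) p q.
  apply: F'; rewrite ?inE ?eqxx // ?pv //; first by rewrite eq_sym K_neq.
  by rewrite eq_sym K_neq.
have rK : subrel (restr [set v'] K) h by move=> w w' /and3P[/Kh].
have [c [c2 [pc _ pc2 cq nc]]] := interior_vertex h_sym h_irr h_acyclic rK con pq npq.
have /and3P[Kpc _ cv'] := pc; rewrite inE in cv'.
have conc : ~~ connect K v' c.
  apply: contraNN nK' => v'c; apply: connect_trans v'c _.
  by apply: connect1; rewrite K_sym -pv.
apply: (separated_not_forced F' _ _ _ cq _ _ _ _ nc).
- by rewrite pv eq_sym.
- by rewrite eq_sym.
- by rewrite eq_sym K_neq.
- exact: not_nbr conc va'.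
- exact: not_nbr conc vb'.
- exact: K_neq.
- exact: K_neq.
Qed.

(** Some path from [p] to [q] avoids [v] and [v']. Its first interior vertex is outside the
    [K]-component of one of them, hence not among the chosen neighbours of that one. *)
Lemma branches_not_off : p != v -> p != v' -> q != v -> q != v' -> False.
Proof.
move=> pv pv' qv qv'.
have nK' : ~~ connect K v' v by rewrite (sym_connect_sym K_sym).
have con : connect (restr [set v; v'] K) p q.
  apply: F; rewrite ?inE ?eqxx ?negb_or ?pv ?qv // eq_sym K_neq //= eq_sym.
    exact: not_nbr va.
  exact: not_nbr vb.
have rK : subrel (restr [set v; v'] K) h by move=> w w' /and3P[/Kh].
have [c [c2 [pc _ pc2 cq nc]]] := interior_vertex h_sym h_irr h_acyclic rK con pq npq.
have /and3P[Kpc _ cS] := pc.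
have cp : c != p by rewrite eq_sym K_neq.
have [vc|vc] := boolP (connect K v c).
  have conc : ~~ connect K v' c.
    apply: contraNN nK => v'c; apply: connect_trans vc _.
    by rewrite (sym_connect_sym K_sym).
  apply: (separated_not_forced F' _ _ cp cq _ _ _ _ nc); try by [rewrite eq_sym | apply: K_neq].
    exact: not_nbr conc va'.
  exact: not_nbr conc vb'.
apply: (separated_not_forced F _ _ cp cq _ _ _ _ nc); try by [rewrite eq_sym | apply: K_neq].
  exact: not_nbr vc va.
exact: not_nbr vc vb.
Qed.

End TwoBranches.

Lemma two_branches (V : finType) (h K : rel V) (v v' a b a' b' p q : V) :
  symmetric h -> irreflexive h -> acyclic h -> symmetric K -> subrel K h ->
  h v v' -> ~~ connect K v v' -> K v a -> K v b -> K v' a' -> K v' b' ->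
  p != q -> ~~ h p q -> forces K v a b p q -> forces K v' a' b' p q -> False.
Proof.
move=> hs hi ha Ks Kh vv' nK va vb va' vb' pq npq F F'.
have v'v : h v' v by rewrite hs.
have nK' : ~~ connect K v' v by rewrite (sym_connect_sym Ks).
have qp : q != p by rewrite eq_sym.
have nqp : ~~ h q p by rewrite hs.
apply: (branches_not_off hs hi ha Ks Kh nK va vb va' vb' pq npq F F').
- exact: (branch_not_end hs hi ha Ks Kh vv' nK va' vb' pq npq F').
- exact: (branch_not_end hs hi ha Ks Kh v'v nK' va vb pq npq F).
- exact: (branch_not_end hs hi ha Ks Kh vv' nK va' vb' qp nqp (forcesC Ks F')).
- exact: (branch_not_end hs hi ha Ks Kh v'v nK' va vb qp nqp (forcesC Ks F)).
Qed.

(** * The shape of a graph whose edge-binomials form a d-sequence *)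

Section NecessaryForm.
Variables (k : fieldType) (n : nat).
Local Notation V := 'I_n.
Variables (e : rel V) (L : seq (V * V)) (p0 : V * V).
Hypotheses (e_sym : symmetric e) (e_irr : irreflexive e).
Hypotheses (e_conn : connected_graph e) (e_uni : unicyclic e).
Hypothesis L_perm : perm_eq L (upper_pairs e).
Hypothesis L_dseq : d_sequence [seq @edge_binomial k n p.1 p.2 | p <- L].
Local Notation pre := (prefix_rel L).
Local Notation "L_[ i ]" := (nth p0 L i) (at level 0, format "L_[ i ]").

Let edgeL := @edge_L n e L p0 e_sym e_irr L_perm.
Let indexL := @index_ends n e L p0 L_perm.
Let preI := @pre_index n e L e_sym e_irr L_perm.

(** By [d_sequence_cycle] the next edge would also have its ends joined by the first [i] edges,
    giving a second cycle. *)
Lemma closing_edge_last i : (i < size L)%N ->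
  connect (pre i) L_[i].1 L_[i].2 -> i.+1 = size L.
Proof.
move=> iL con; apply/eqP; rewrite eqn_leq iL /= leqNgt; apply/negP => i1L.
have ii1 : (i <= i.+1 < size L)%N by rewrite leqnSn.
have con' := d_sequence_cycle L_dseq ii1 con.
apply: (unicyclic_two_edges e_sym e_irr e_uni (@pre_sym _ L i) _ _ _ _ _ _ con con').
- exact: (pre_sub e_sym e_irr L_perm).
- exact: edgeL.
- exact: edgeL.
- move/(congr1 (index^~ (map (@ends n) L))).
  by rewrite -!/(ends _) !indexL // => /eqP; rewrite ltn_eqF.
- by apply: (L_notin_pre p0 e_sym e_irr L_perm); rewrite leqnn.
- exact: (L_notin_pre p0 e_sym e_irr L_perm).
Qed.

Variable r : nat.
Hypotheses (r_last : r.+1 = size L) (r_con : connect (pre r) L_[r].1 L_[r].2).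
Local Notation h := (pre r).
Local Notation p := (L_[r].1).
Local Notation q := (L_[r].2).

Let rL : (r < size L)%N. Proof. by rewrite -r_last. Qed.
Let h_sym : symmetric h := @pre_sym _ L r.
Let he : subrel h e := @pre_sub _ _ _ e_sym e_irr L_perm r.
Let h_irr : irreflexive h.
Proof. by move=> a; apply: contraFF (e_irr a) => /he. Qed.
Let npq : ~~ h p q.
Proof. by apply: (L_notin_pre p0 e_sym e_irr L_perm); rewrite leqnn. Qed.
Let pq : p != q.
Proof. by apply: contraTneq (edgeL rL) => ->; rewrite e_irr. Qed.

Lemma edge_last a b : e a b -> ~~ h a b -> [set a; b] = [set p; q].
Proof.
move=> ab; rewrite preI // -leqNgt => le.
have lt : (index [set a; b] (map (@ends n) L) < size (map (@ends n) L))%N.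
  by rewrite index_mem -(edge_mem e_sym e_irr L_perm).
have E : index [set a; b] (map (@ends n) L) = r.
  by apply/eqP; rewrite eqn_leq le andbT -ltnS r_last -(size_map (@ends n)).
rewrite -(nth_index (ends p0) (s := map (@ends n) L) (x := [set a; b])).
  by rewrite E (nth_map p0).
by rewrite -(edge_mem e_sym e_irr L_perm).
Qed.

Lemma e_add_edge : e =2 add_edge h p q.
Proof.
move=> a b; rewrite /add_edge; have [hab|hab] /= := boolP (h a b); first exact: he.
apply/idP/orP => [ab|[] /andP[/eqP -> /eqP ->]].
- by case: (set2_eq (edge_last ab hab)) => -[-> ->]; rewrite !eqxx; [left | right].
- exact: edgeL.
- by rewrite e_sym edgeL.
Qed.

Lemma h_connected a b : connect h a b.
Proof.
have cs := sym_connect_sym h_sym.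
apply: connect_sub (e_conn.2 a b) => w w'; rewrite e_add_edge.
case/or3P=> [ww'|/andP[/eqP-> /eqP->] //|/andP[/eqP-> /eqP->]].
  exact: connect1.
by rewrite cs.
Qed.

(** If an edge of [h] could be bypassed, the rest of [h] would still connect [p] to [q], and that
    edge and [p q] would close different cycles. *)
Lemma h_acyclic : acyclic h.
Proof.
move=> u w uw; apply/negP => con.
pose K := del_edge h u w.
have Ks : symmetric K := del_edge_sym u w h_sym.
have Kh : subrel K h by move=> a b /andP[].
have conpq : connect K p q.
  apply: connect_sub r_con => a b ab; have [E|ne] := eqVneq [set a; b] [set u; w].
    by case: (set2_eq E) => -[-> ->] //; rewrite (sym_connect_sym Ks).
  by apply: connect1; rewrite /K /del_edge /= ab.
apply: (unicyclic_two_edges e_sym e_irr e_uni Ks _ _ _ _ _ _ conpq con).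
- by move=> a b /Kh /he.
- exact: edgeL.
- exact: he.
- case/set2_eq => [[Ep Eq]|[Ep Eq]]; first by move: npq; rewrite Ep Eq uw.
  by move: npq; rewrite Ep Eq h_sym uw.
- by apply: contraNN npq => /Kh.
- by rewrite /K /del_edge /= eqxx andbF.
Qed.

Record branch (i : nat) (v a b : V) : Prop := Branch {
  branch_lt : (i < r)%N;
  branch_end : v \in ends L_[i];
  branch_neq : a != b;
  branch_l : pre i v a;
  branch_r : pre i v b }.

(** Of three edges at [v], the last in the order plays the part of the i-th. *)
Lemma branch_exists v a b c : h v a -> h v b -> h v c ->
  a != b -> a != c -> b != c -> exists i a' b', branch i v a' b'.
Proof.
pose idx a := index [set v; a] (map (@ends n) L).
have idx_inj a1 b1 : h v a1 -> h v b1 -> idx a1 = idx b1 -> a1 = b1.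
  move=> /he va /he vb /(congr1 (nth (ends p0) (map (@ends n) L))).
  by rewrite !nth_index -?(edge_mem e_sym e_irr L_perm) // => /set2_eq [[]|[<- <-]].
have step a1 b1 c1 : h v a1 -> h v b1 -> h v c1 -> a1 != b1 -> a1 != c1 -> b1 != c1 ->
    (idx a1 <= idx c1)%N -> (idx b1 <= idx c1)%N -> exists i a' b', branch i v a' b'.
  move=> va vb vc ab ac bc la lb; exists (idx c1), a1, b1.
  have cr : (idx c1 < r)%N by rewrite -preI // he.
  split=> //.
  - have E : ends L_[idx c1] = [set v; c1].
      rewrite -(nth_map p0 (ends p0)) ?(ltn_trans cr) // nth_index //.
      by rewrite -(edge_mem e_sym e_irr L_perm) he.
    by rewrite E !inE eqxx.
  - rewrite preI ?he // ltn_neqAle la andbT.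
    by apply: contraNneq ac => /idx_inj ->.
  - rewrite preI ?he // ltn_neqAle lb andbT.
    by apply: contraNneq bc => /idx_inj ->.
move=> va vb vc ab ac bc.
have [lab|lba] := leqP (idx a) (idx b).
  have [lbc|lcb] := leqP (idx b) (idx c).
    by apply: (step a b c) => //; apply: leq_trans lbc.
  by apply: (step a c b) => //; rewrite ?(ltnW lcb) // eq_sym.
have [lac|lca] := leqP (idx a) (idx c).
  by apply: (step a b c) => //; apply: leq_trans lac; apply: ltnW.
by apply: (step b c a) => //; rewrite ?(ltnW lba) ?(ltnW lca) // eq_sym.
Qed.

Let branch_sep i v a b (S : {set V}) : branch i v a b -> v \in S ->
  ~~ connect (restr S (pre i)) a b.
Proof.
case=> ir _ ab va vb vS.
have ph : subrel (pre i) h := pre_mono e_sym e_irr L_perm (ltnW ir).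
have := acyclic_sep h_sym h_acyclic (ph _ _ va) (ph _ _ vb) ab vS.
apply: contraNN; apply: connect_mono => w w' /and3P[/ph ww' wS w'S].
by rewrite /restr /= ww' wS.
Qed.

Let pre_acyclic i : (i < r)%N -> ~~ connect (pre i) L_[i].1 L_[i].2.
Proof.
move=> ir; have iL : (i < size L)%N := ltn_trans ir rL.
have hL : h L_[i].1 L_[i].2 by rewrite preI ?edgeL // -/(ends _) indexL.
apply: contraNN (h_acyclic hL); apply: connect_mono => a b ab.
rewrite /del_edge /= (pre_mono e_sym e_irr L_perm (ltnW ir)) //=.
have eab := pre_sub e_sym e_irr L_perm ab; move: ab; rewrite preI // => ab.
by apply: contraTneq ab => ->; rewrite -/(ends _) indexL // ltnn.
Qed.

(** Taking [v] alone for [S], a later edge missing [v] would have its ends connected by earlier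
    edges, closing a cycle in [h]. *)
Lemma branch_later i j v a b : branch i v a b -> (i < j < r)%N ->
  v \in ends L_[j].
Proof.
move=> br /andP[ij jr]; apply: contraT => vj.
have [ir vi ab va vb] := br.
have ijL : (i <= j < size L)%N by rewrite (ltnW ij) (ltn_trans jr rL).
have irr w : pre i v w -> w \notin [set v].
  by move=> /(pre_sub e_sym e_irr L_perm) vw; rewrite inE;
     apply: contraTneq vw => ->; rewrite e_irr.
move: vj; rewrite !inE negb_or => /andP[v1 v2].
have := d_sequence_branch L_dseq ijL vi va vb (set11 v) (irr _ va) (irr _ vb)
  (branch_sep br (set11 v)).
rewrite !inE ![_ == v]eq_sym => /(_ v1 v2) con.
case/negP: (pre_acyclic jr); apply: connect_mono con => w w' /and3P[ww' _ _].
exact: (pre_mono e_sym e_irr L_perm (ltnW ij)).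
Qed.

Lemma branch_forces i v a b : branch i v a b -> forces (pre i) v a b p q.
Proof.
move=> br S vS aS bS pS qS; have [ir vi ab va vb] := br.
have irL : (i <= r < size L)%N by rewrite (ltnW ir) rL.
exact: (d_sequence_branch L_dseq irL vi va vb vS aS bS (branch_sep br vS) pS qS).
Qed.

(** The later of the two edges meets both vertices by [branch_later], so it is the edge between
    them, and both branch there: the situation of [two_branches]. *)
Lemma branch_unique i v a b i' v' a' b' :
  branch i v a b -> branch i' v' a' b' -> v = v'.
Proof.
wlog ii' : i v a b i' v' a' b' / (i <= i')%N.
  move=> H br br'; case: (leqP i i') => [le|/ltnW le]; first exact: H le br br'.
  by apply/esym; apply: H le br' br.
move=> br br'; apply/eqP; apply: contraT => vv'.
have [ir' vi' ab' va' vb'] := br'; have [ir vi ab va vb] := br.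
have pm := pre_mono e_sym e_irr L_perm ii'.
have vi2 : v \in ends L_[i'].
  move: ii'; rewrite leq_eqVlt => /orP[/eqP <- //|ii'].
  by apply: (branch_later br); rewrite ii'.
have {br vi va vb} br : branch i' v a b by split=> //; apply: pm.
have [_ _ _ va vb] := br.
have i'L : (i' < size L)%N := ltn_trans ir' rL.
have hL : h L_[i'].1 L_[i'].2 by rewrite preI ?edgeL // -/(ends _) indexL.
have E : (v = L_[i'].1 /\ v' = L_[i'].2) \/ (v = L_[i'].2 /\ v' = L_[i'].1).
  move: vi2 vi' vv'; rewrite !inE => /orP[]/eqP-> /orP[]/eqP->; rewrite ?eqxx //; by auto.
have hvv' : h v v' by case: E => -[-> ->] //; rewrite h_sym.
have nK : ~~ connect (pre i') v v'.
  have := pre_acyclic ir'; case: E => -[-> ->] //.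
  by rewrite (sym_connect_sym (@pre_sym _ L i')).
case: (two_branches h_sym h_irr h_acyclic (@pre_sym _ L i') _ hvv' nK va vb va' vb'
  pq npq (branch_forces br) (branch_forces br')).
exact: (pre_mono e_sym e_irr L_perm (ltnW ir')).
Qed.

(** Otherwise some path from [p] to [q] avoids [v], and its first interior vertex [c] must be [a] or
    [b], as else [v] and [c] contradict forcing. Then [c] has the three neighbours [p], [c2] and
    [v], so it is a second branching vertex. *)
Lemma branch_at_end i v a b : branch i v a b -> v = p \/ v = q.
Proof.
move=> br; have [->|vp] := eqVneq v p; [by left | have [->|vq] := eqVneq v q; [by right |]].
exfalso.
have [ir vi ab va vb] := br; have F := branch_forces br.
have ph := pre_mono e_sym e_irr L_perm (ltnW ir).
have neq w w' : pre i w w' -> w != w'.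
  by move=> /ph ww'; apply: contraTneq ww' => ->; rewrite h_irr.
have con : connect (restr [set v] (pre i)) p q.
  by apply: F; rewrite !inE ?eqxx // eq_sym //; apply: neq.
have rh : subrel (restr [set v] (pre i)) h by move=> w w' /and3P[/ph].
have [c [c2 [pc cc2 pc2 cq nc]]] := interior_vertex h_sym h_irr h_acyclic rh con pq npq.
have cp : c != p by case/and3P: pc => /neq; rewrite eq_sym.
have [cab|] := boolP (c \in [set a; b]); last first.
  rewrite !inE negb_or => /andP[ca cb].
  by apply: (separated_not_forced ph F vp vq cp cq ca cb _ _ nc); apply: neq.
have hcv : h c v by rewrite h_sym; move: cab; rewrite !inE => /orP[]/eqP->; apply: ph.
have hcp : h c p by rewrite h_sym; apply: rh.
have vc2 : v != c2 by case/and3P: cc2 => _ _; rewrite inE eq_sym.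
have [i' [a' [b' br']]] := branch_exists hcv hcp (rh _ _ cc2) vp vc2 pc2.
have E := branch_unique br br'; rewrite -E in hcv.
by rewrite h_irr in hcv.
Qed.

Lemma necessary_center : exists k0 z, center_plus_edge e h k0 z.
Proof.
have [/forallP few|] := boolP [forall v, (v != p) ==> [forall a, forall b, forall c,
    [&& h v a, h v b & h v c] ==> [|| a == b, a == c | b == c]]].
  exists p, q; split=> //; [exact: h_acyclic | | exact: e_add_edge].
  move=> v vp a b c va vb vc; move: (few v); rewrite vp => /forallP /(_ a).
  by move=> /forallP /(_ b) /forallP /(_ c); rewrite va vb vc.
rewrite negb_forall => /existsP [v]; rewrite negb_imply => /andP[vp nf].
case: (few_nbrsVbranch h v) => [few|[a [b [c [va vb vc [ab ac bc]]]]]].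
  case/negP: nf; do 3![apply/forallP => ?]; apply/implyP => /and3P[]; exact: few.
have [i [a' [b' br]]] := branch_exists va vb vc ab ac bc.
case: (branch_at_end br) => vE; first by rewrite vE eqxx in vp.
exists q, p; split=> //; [exact: h_acyclic | | by rewrite eq_sym | by rewrite h_sym |].
  move=> w wq; case: (few_nbrsVbranch h w) => // -[a1 [b1 [c1 [wa wb wc [ab1 ac1 bc1]]]]].
  have [i1 [a2 [b2 br2]]] := branch_exists wa wb wc ab1 ac1 bc1.
  by rewrite -(branch_unique br br2) vE eqxx in wq.
by move=> a1 b1; rewrite e_add_edge /add_edge; congr (_ || _); rewrite orbC.
Qed.

End NecessaryForm.

Theorem d_sequence_center (k : fieldType) (n : nat) (e : rel 'I_n) :
  symmetric e -> irreflexive e -> connected_graph e -> unicyclic e ->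
  edge_binomials_form_d_sequence k e ->
  exists h k0 z, center_plus_edge e h k0 z /\ forall a b, connect h a b.
Proof.
move=> es ei ec eu [s]; rewrite binomials_ofE => sE sd.
have [C [[c [uc sc _]] _]] := eu.
have [x0 _] : exists x0, x0 \in c by case: (c) sc => // x0 c' _; exists x0; rewrite mem_head.
pose p0 := (x0, x0).
(* The order on binomials is lifted to an order on edges through the positions in the list. *)
have /(perm_iotaP 0) [Is IsE sI] := sE.
pose L := [seq nth p0 (upper_pairs e) i | i <- Is].
have sL : s = [seq edge_binomial k p.1 p.2 | p <- L].
  rewrite sI -map_comp; apply/eq_in_map => i iI.
  have : i \in iota 0 (size (upper_pairs e)) by move: iI; rewrite (perm_mem IsE) size_map.
  by rewrite mem_iota => /andP[_ iU]; rewrite (nth_map p0).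
have LU : perm_eq L (upper_pairs e).
  rewrite -[X in perm_eq _ X](mkseq_nth p0) /mkseq; apply: perm_map.
  by rewrite size_map in IsE.
rewrite sL in sd.
have [r rL con] := cycle_closing p0 es ei LU uc sc.
have r_last := closing_edge_last es ei eu LU sd rL con.
have [k0 [z cpe]] := necessary_center es ei eu LU sd r_last con.
exists (prefix_rel L r), k0, z; split=> // a b.
exact: (h_connected es ei ec LU r_last con).
Qed.

Theorem theorem0p1 (k : fieldType) (n : nat) (e : rel 'I_n)
  (e_sym : symmetric e) (e_irr : irreflexive e)
  (e_conn : connected_graph e) (e_unicyclic : unicyclic e) :
  (edge_binomials_form_d_sequence k e <->
     [\/ form_a e, form_b e | form_c e]) /\
  (2%N \notin [pchar k] -> [\/ form_a e, form_b e | form_c e] ->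
     parity_edge_binomials_form_d_sequence k e).
Proof.
split; last first.
  move=> _ /forms_center [h [k0 [z [col [cpe colP]]]]].
  exact: center_plus_edge_parity cpe colP.
split=> [d|/forms_center [h [k0 [z [_ [cpe _]]]]]]; last first.
  exact: center_plus_edge_d_sequence cpe.
have [h [k0 [z [cpe hc]]]] := d_sequence_center e_sym e_irr e_conn e_unicyclic d.
apply: (center_forms _ cpe hc) => a; apply: contraFF (e_irr a) => haa.
by rewrite (cpe_edge cpe) /add_edge haa.
Qed.
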